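(* Let $(\Omega,\Sigma,\mu)$ be a measure space with $\mu(\Omega)=+\infty$ and let $p>1$. The set $L_p(\Omega)-\bigcup_{1\leq q<p}L_q(\Omega)$ is maximal spaceable in $L_p(\Omega)$ if either (a) $L_p(\Omega)-L_r(\Omega)\neq\emptyset$ for some $1\leq r<p$ and $\aleph_0\leq ent(\Omega)\leq\mathfrak{c}$; or (b) $(\Omega,\Sigma,\mu)$ is $\zeta$-bounded for some cardinal number $\zeta$ with $\mathfrak{c}\leq\zeta<ent(\Omega)$.
   Context: $L_s(\Omega)$ ($0<s<\infty$) is the space of $\mu$-a.e. classes of measurable $\mathbb{K}$-valued $f$ with $\int|f|^s d\mu<\infty$ (normed/quasi-normed as usual); $L_p(\Omega)-\bigcup_q L_q(\Omega)$ is the set of $f\in L_p(\Omega)$ lying in no $L_q(\Omega)$. A subset $M$ of a topological vector space $E$ is maximal spaceable if $M\cup\{0\}$ contains a closed linear subspace $F$ of $E$ with $\dim F=\dim E$ (algebraic dimensions). $\mathfrak{c}=\#\mathbb{R}$. $\Sigma_{fin}:=\{A\in\Sigma:\mu(A)<+\infty\}$; $A\sim B$ iff $\mu((A-B)\cup(B-A))=0$; $ent(\Omega):=\#(\Sigma_{fin}/\!\sim)$. The space is $\zeta$-bounded if every $A\in\Sigma_{fin}$ with $\mu(A)>0$ has at most $\zeta$ subsets of positive measure belonging to pairwise different classes of $\Sigma_{fin}/\!\sim$. *)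

(* Defs.v *)
From HB Require Import structures.
From mathcomp Require Import all_boot all_order all_algebra.
From mathcomp Require Import all_classical all_reals all_analysis.
From mathcomp Require Import complex.
Set Implicit Arguments. Unset Strict Implicit. Unset Printing Implicit Defensive.
Import Order.TTheory GRing.Theory Num.Theory.
Import numFieldNormedType.Exports.
Local Open Scope classical_set_scope.
Local Open Scope ring_scope.

Section Lp_defs.
Context d (T : measurableType d) (R : realType).
Variable mu : {measure set T -> \bar R}.

Definition Sfin (A : set T) : Prop := measurable A /\ (mu A < +oo)%E.

Definition msim (A B : set T) : Prop := mu ((A `\` B) `|` (B `\` A)) = 0%E.

Definition Sfin_classes : set (set (set T)) :=
  [set C | exists A, Sfin A /\ C = [set B | Sfin B /\ msim B A]].

Definition zeta_bounded (Z : Type) : Prop :=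
  forall A : set T, Sfin A -> (0 < mu A)%E ->
  forall S : set (set T),
    (forall B, S B -> measurable B /\ B `<=` A /\ (0 < mu B)%E) ->
    (forall B C, S B -> S C -> msim B C -> B = C) ->
    (S #<= [set: Z])%card.

Variables (K : fieldType) (absK : K -> R) (measK : (T -> K) -> Prop).

Definition inL (s : R) (f : T -> K) : Prop :=
  measK f /\ finite_norm mu s%:E (fun x => absK (f x)).

Definition Ldist (s : R) (f g : T -> K) : \bar R :=
  Lnorm mu s%:E (fun x => (absK (f x - g x))%:E).

Definition ae_eqK (f g : T -> K) : Prop := {ae mu, forall x, f x = g x}.

(* A linear subspace of L_s, given as the set of all representatives of its
   elements (hence saturated under a.e. equality). *)
Definition Lsubspace (s : R) (F : set (T -> K)) : Prop :=
  [/\ F `<=` inL s,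
      (forall f g, F f -> inL s g -> ae_eqK f g -> F g),
      F (fun _ => 0),
      (forall f g, F f -> F g -> F (fun x => f x + g x)) &
      (forall (c : K) f, F f -> F (fun x => c * f x))].

Definition Lclosed (s : R) (F : set (T -> K)) : Prop :=
  forall g, inL s g ->
    (forall e : R, 0 < e -> exists f, F f /\ (Ldist s f g < e%:E)%E) -> F g.

Definition hamel_basis (F : set (T -> K)) (B : set (T -> K)) : Prop :=
  [/\ B `<=` F,
      (forall n (b : 'I_n -> T -> K) (c : 'I_n -> K),
          injective b -> (forall i, B (b i)) ->
          ae_eqK (fun x => \sum_(i < n) c i * b i x) (fun _ => 0) ->
          forall i, c i = 0) &
      (forall f, F f -> exists n (b : 'I_n -> T -> K) (c : 'I_n -> K),
          (forall i, B (b i)) /\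
          ae_eqK f (fun x => \sum_(i < n) c i * b i x))].

Definition same_dim (F G : set (T -> K)) : Prop :=
  exists BF BG, [/\ hamel_basis F BF, hamel_basis G BG & (BF #= BG)%card].

Definition Lp_minus_Lq_maximal_spaceable (p : R) : Prop :=
  exists F : set (T -> K),
    [/\ Lsubspace p F, Lclosed p F, same_dim F (inL p) &
        forall f, F f ->
          ae_eqK f (fun _ => 0) \/ (forall q : R, 1 <= q < p -> ~ inL q f)].

End Lp_defs.

Definition measR d (T : measurableType d) (R : realType) (f : T -> R) : Prop :=
  measurable_fun setT f.

Definition absC (R : realType) (z : R[i]) : R :=
  Num.sqrt (complex.Re z ^+ 2 + complex.Im z ^+ 2).
Definition measC d (T : measurableType d) (R : realType) (f : T -> R[i]) : Prop :=
  measurable_fun setT (fun x => complex.Re (f x)) /\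
  measurable_fun setT (fun x => complex.Im (f x)).

(* Main.v *)
Require Import Defs.
From HB Require Import structures.
From mathcomp Require Import all_boot all_order all_algebra.
From mathcomp Require Import all_classical all_reals all_analysis.
From mathcomp Require Import measurable_realfun.
From mathcomp Require Import complex zify lra.
Set Implicit Arguments. Unset Strict Implicit. Unset Printing Implicit Defensive.
Import Order.TTheory GRing.Theory Num.Theory.
Import numFieldNormedType.Exports.
Local Open Scope classical_set_scope.

(** Call [g >= 0] bad if it lies in the unit ball of [L_p] but in no [L_q] with
   [1 <= q < p]. An infinite-measure union of an increasing sequence of sets of
   finite measure carries infinitely many disjointly supported bad functions:
   spread the mass [2 ^ - (k + 1)] of [g ^ p] over a set of huge measure. The
   closed span of a family [(g_c)_(c : G)] of bad functions with a.e. disjoint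
   supports is a copy of [l_p(G)]; a nonzero element is a nonzero multiple of
   some [g_c] on its support, hence is in no [L_q]. For infinite [G], coding
   the finite prefixes of [s : nat -> G] by elements of [G] turns the sequences
   into a linearly independent family of [l_p(G)] of size [#G ^ aleph_0]. As an
   element of [L_p] is determined by countably many sets of finite measure, the
   span has the dimension of [L_p] as soon as [ent <= #G ^ aleph_0].

   In case (a), [ent <= c = aleph_0 ^ aleph_0] and [G] is countable; the level
   sets of an element of [L_p - L_r] provide the family. In case (b), take a
   maximal family. By maximality there is a set [R0] of finite measure such that
   every set of finite measure is, up to null sets, contained in the union of
   [R0] and of countably many supports. Such a union is sigma-finite, and its
   subsets have at most [zeta] classes: up to a factor [2 ^ aleph_0], the
   classes of the n-th piece are those of a subset of measure [<= 2 ^ - n]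
   (otherwise a minimal counterexample would be an atom), and these subsets have
   a union of finite measure, to which [zeta]-boundedness applies. Hence
   [ent <= #G ^ aleph_0 * zeta], and [zeta < ent] forces
   [ent <= #G ^ aleph_0]. *)

(** * Cardinals *)

Lemma sval_inj (X : Type) (P : X -> Prop) : injective (@sval X P).
Proof. by move=> [x p] [y q] /= e; exact: eq_exist. Qed.

(** Cardinal comparison is stated on types, so that products, function types and dependent products
    can be compared directly. *)
Definition embeds (X Y : Type) : Prop := exists f : X -> Y, injective f.

Lemma embeds_trans X Y Z : embeds X Y -> embeds Y Z -> embeds X Z.
Proof. by move=> [f fi] [g gi]; exists (g \o f); exact: inj_comp. Qed.

Lemma embeds_refl X : embeds X X.
Proof. by exists id. Qed.

Lemma embeds_prod X Y X' Y' :
  embeds X X' -> embeds Y Y' -> embeds (X * Y) (X' * Y').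
Proof.
move=> [f fi] [g gi]; exists (fun a => (f a.1, g a.2)).
by move=> [a b] [c e] /= [/fi -> /gi ->].
Qed.

Lemma embeds_pi (I : Type) (X Y : I -> Type) :
  (forall i, embeds (X i) (Y i)) -> embeds (forall i, X i) (forall i, Y i).
Proof.
move=> /(_ _)/cid f; exists (fun x i => sval (f i) (x i)) => x y e.
apply: functional_extensionality_dep => i; apply: (svalP (f i)).
exact: (congr1 (fun h => h i) e).
Qed.

Lemma embeds_fun (I X Y : Type) : embeds X Y -> embeds (I -> X) (I -> Y).
Proof. by move=> XY; apply: embeds_pi. Qed.

Lemma embeds_curry (I J X : Type) : embeds (I -> J -> X) (I * J -> X).
Proof.
exists (fun f a => f a.1 a.2) => f g e; apply: funext => i; apply: funext => j.
exact: (congr1 (fun h => h (i, j)) e).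
Qed.

Lemma embeds_precomp (I J X : Type) (h : J -> I) (k : I -> J) :
  cancel k h -> embeds (I -> X) (J -> X).
Proof.
move=> hk; exists (fun f => f \o h) => f g e; apply: funext => i.
by have := congr1 (fun u => u (k i)) e; rewrite /= hk.
Qed.

Lemma embeds_nat2 (X : Type) : embeds (nat -> nat -> X) (nat -> X).
Proof.
apply: embeds_trans (embeds_curry _ _ _) _.
apply: (@embeds_precomp _ _ _ (fun n => odflt (0, 0) (unpickle n)) pickle).
by move=> x; rewrite pickleK.
Qed.

Lemma embeds_sqr_fun (X : Type) : embeds ((nat -> X) * (nat -> X)) (nat -> X).
Proof.
apply: embeds_trans (@embeds_nat2 X).
exists (fun a n => if n is 0 then a.1 else a.2) => -[f g] [f' g'] /= e.
by congr pair; [have := congr1 (@^~ 0) e|have := congr1 (@^~ 1) e].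
Qed.

Lemma embeds_total (X Y : Type) : embeds X Y \/ embeds Y X.
Proof.
have [[y0]|noY] := pselect (inhabited Y); last first.
  by right; exists (fun y => False_rect X (noY (inhabits y))) => y;
    case: (noY (inhabits y)).
have [[x0]|noX] := pselect (inhabited X); last first.
  by left; exists (fun y => False_rect Y (noX (inhabits y))) => y;
    case: (noX (inhabits y)).
pose P := {Df : set X * (X -> Y) | {in Df.1 &, injective Df.2}}.
pose R (a b : P) := `[< (sval a).1 `<=` (sval b).1 /\
   forall x, (sval a).1 x -> (sval a).2 x = (sval b).2 x >].
have P0 : P by exists (set0, fun=> y0) => x y; rewrite inE.
have [| | |[[D f] /= fi] fmax] := @ZL_preorder P P0 R.
- by move=> a; apply/asboolP; split.
- move=> b a c /asboolP[ab abE] /asboolP[bc bcE]; apply/asboolP; split.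
    exact: subset_trans bc.
  by move=> x ax; rewrite abE// bcE//; exact: ab.
- move=> A Atot.
  pose U : set X := [set x | exists2 a, A a & (sval a).1 x].
  pose h x := if pselect (U x) is left e then
    (sval (s2val (cid2 e))).2 x else y0.
  have hE a x : A a -> (sval a).1 x -> h x = (sval a).2 x.
    move=> Aa ax; rewrite /h; case: pselect => [e|]; last first.
      by case; exists a.
    case: (cid2 e) => b /= Ab bx.
    by case: (Atot _ _ Aa Ab) => /asboolP[_ ->].
  have hi : {in U &, injective h}.
    move=> x y /set_mem[a Aa ax] /set_mem[b Ab byy].
    rewrite (hE _ _ Aa ax) (hE _ _ Ab byy).
    case: (Atot _ _ Aa Ab) => /asboolP[sub subE].
      by rewrite subE// => /(svalP b) -> //; rewrite ?inE//; exact: sub.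
    by rewrite (subE y)// => /(svalP a) -> //; rewrite ?inE//; exact: sub.
  exists (exist _ (U, h) hi) => a Aa; apply/asboolP; split => /=.
    by move=> x ax; exists a.
  by move=> x ax; rewrite (hE a).
have [[x Dx]|allD] := pselect (exists x, ~ D x); last first.
  left; exists f => x y; apply: (fi); rewrite inE;
    apply: contrapT => nD; apply: allD; eexists; exact: nD.
have [[y fy]|surj] := pselect (exists y, forall x, D x -> f x <> y).
  pose g z := if pselect (z = x) then y else f z.
  have gx : g x = y by rewrite /g; case: pselect.
  have gE z : D z -> g z = f z by move=> Dz; rewrite /g; case: pselect => // zx; case: Dx; rewrite -zx.
  have gi : {in D `|` [set x] &, injective g}.
    move=> a b /set_mem[Da|->] /set_mem[Db|->]//.
    - by rewrite !gE//; apply: (fi); rewrite inE.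
    - by rewrite gx gE// => /fy.
    - by rewrite gx gE// => /esym/fy.
  have /fmax/asboolP[/= + _] : R (exist _ (D, f) fi) (exist _ (D `|` [set x], g) gi).
    by apply/asboolP; split => /= [z Dz|z Dz]; [left|rewrite gE].
  by move=> /(_ x) H; case: Dx; apply: H; right.
right.
have s y : exists2 x, D x & f x = y.
  apply: contrapT => H; apply: surj; exists y => x' Dx' fx'; apply: H.
  by exists x'.
exists (fun y => s2val (cid2 (s y))) => a b e.
by rewrite -(s2valP' (cid2 (s a))) e (s2valP' (cid2 (s b))).
Qed.

(** Zorn's lemma on injective pairings of [D] into [D], with [D] containing a copy of [nat]. For a
    maximal [D], either the complement embeds into [D], and then [X] embeds into [D] by tagging, or
    [D] embeds into its complement and the pairing can be enlarged. *)
Lemma embeds_sqr (X : Type) : embeds nat X -> embeds (X * X) X.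
Proof.
move=> [nX nXi].
pose ok (Df : set X * (X -> X -> X)) :=
  [/\ range nX `<=` Df.1,
      forall x y, Df.1 x -> Df.1 y -> Df.1 (Df.2 x y) &
      forall x y x' y', Df.1 x -> Df.1 y -> Df.1 x' -> Df.1 y' ->
         Df.2 x y = Df.2 x' y' -> x = x' /\ y = y'].
pose P := {Df | ok Df}.
pose R (a b : P) := `[< (sval a).1 `<=` (sval b).1 /\
   forall x y, (sval a).1 x -> (sval a).1 y -> (sval a).2 x y = (sval b).2 x y >].
(* The starting pairing is that of [nat], transported to [range nX]. *)
have P0 : P.
  pose inv x := xget 0 [set n | nX n = x].
  have invK n : inv (nX n) = n.
    by rewrite /inv; case: xgetP => [m _ /nXi//|/(_ n)]; case.
  exists (range nX, fun x y => nX (pickle (inv x, inv y))); split => //=.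
    by move=> x y _ _; exists (pickle (inv x, inv y)).
  move=> ? ? ? ? [a _ <-] [b _ <-] [a' _ <-] [b' _ <-] /nXi.
  by rewrite !invK => /(pcan_inj pickleK) [-> ->].
have [| | |[[D f] /= [Dn fD fi]] fmax] := @ZL_preorder P P0 R.
- by move=> a; apply/asboolP; split.
- move=> b a c /asboolP[ab abE] /asboolP[bc bcE]; apply/asboolP; split.
    exact: subset_trans bc.
  by move=> x y ax ay; rewrite abE// bcE//; exact: ab.
- move=> A Atot.
  (* The empty chain is bounded by [P0], because its union would miss [range nX]. *)
  have [[a0 Aa0]|A0] := pselect (exists a, A a); last first.
    by exists P0 => s As; case: A0; exists s.
  pose U : set X := [set x | exists2 a, A a & (sval a).1 x].
  pose h x y := if pselect (exists2 a, A a & (sval a).1 x /\ (sval a).1 y)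
    is left e then (sval (s2val (cid2 e))).2 x y else x.
  have hE a x y : A a -> (sval a).1 x -> (sval a).1 y -> h x y = (sval a).2 x y.
    move=> Aa ax ay; rewrite /h; case: pselect => [e|]; last first.
      by case; exists a.
    case: (cid2 e) => b /= Ab [bx by'].
    by case: (Atot _ _ Aa Ab) => /asboolP[_ ->].
  have U2 x y : U x -> U y -> exists2 a, A a & (sval a).1 x /\ (sval a).1 y.
    move=> [a Aa ax] [b Ab byy].
    case: (Atot _ _ Aa Ab) => /asboolP[sub subE].
      by exists b => //; split => //; exact: sub.
    by exists a => //; split => //; exact: sub.
  have okU : ok (U, h).
    split => /=.
    - by move=> x nx; exists a0 => //; case: (svalP a0) => + _ _; apply.
    - move=> x y Ux Uy; have [a Aa [ax ay]] := U2 _ _ Ux Uy.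
      rewrite (hE a)//; exists a => //.
      by case: (svalP a) => _ + _; apply.
    - move=> x y x' y' Ux Uy Ux' Uy'.
      have [a Aa [ax ay]] := U2 _ _ Ux Uy.
      have [b Ab [bx' by']] := U2 _ _ Ux' Uy'.
      rewrite (hE a)// (hE b)//.
      case: (Atot _ _ Aa Ab) => /asboolP[sub subE].
        rewrite subE//; case: (svalP b) => _ _; apply => //; exact: sub.
      rewrite (subE x')//; case: (svalP a) => _ _; apply => //; exact: sub.
  exists (exist _ (U, h) okU) => a Aa; apply/asboolP; split => /=.
    by move=> x ax; exists a.
  by move=> x y ax ay; rewrite (hE a).
pose t n := nX n.
have Dt n : D (t n) by apply: (Dn); exists n.
have ti m n : m <> n -> t m <> t n by move=> mn /nXi.
(* The points [t 0] and [t 1] of [D] serve as tags for the points inside and outside [D]. *)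
have [[h hi]|[k ki]] := embeds_total {x | D x} {x | ~ D x}; last first.
  have ek (x : X) : exists y, D y /\
     ((D x -> y = f (t 0) x) /\ (forall (nx : ~ D x),
        y = f (t 1) (sval (k (exist _ x nx))))).
    have [Dx|nDx] := pselect (D x).
      by by exists (f (t 0) x); split=> //; apply: (fD).
    exists (f (t 1) (sval (k (exist _ x nDx)))); split=> //.
      by apply: (fD) => //; exact: svalP.
    by split => // nx; rewrite (Prop_irrelevance nx nDx).
  pose e x := sval (cid (ek x)).
  have eD x : D (e x) by rewrite /e; case: cid => ? [].
  have ei : injective e.
    move=> x y; rewrite /e; case: cid => /= a [Da [a0 a1]].
    case: cid => /= b [Db [b0 b1]].
    have [Dx|nDx] := pselect (D x); have [Dy|nDy] := pselect (D y).
    - by rewrite a0// b0// => /fi[].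
    - rewrite a0// b1// => /fi[]//; first exact: svalP.
      by move=> /ti; case.
    - rewrite a1// b0// => /fi[]//; first exact: svalP.
      by move=> /ti; case.
    - rewrite a1// b1// => /fi[]//; try exact: svalP.
      by move=> _ /sval_inj/ki [].
  exists (fun a => f (e a.1) (e a.2)) => -[a b] [a' b'] /= /fi[]//.
  by move=> /ei -> /ei ->.
(* [hh @` D] is a copy of [D] outside [D]; the three new quadrants of
   [(D `|` hh @` D) ^ 2] are injected into that copy. *)
exfalso.
pose hh x := if pselect (D x) is left e then sval (h (exist _ x e)) else x.
have hhi x y : D x -> D y -> hh x = hh y -> x = y.
  rewrite /hh; case: pselect => // dx _; case: pselect => // dy _.
  by move=> /sval_inj/hi [].
have hhn x : D x -> ~ D (hh x).
  by rewrite /hh; case: pselect => // dx _; exact: (svalP (h (exist _ x dx))).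
pose D2 := D `|` [set hh x | x in D].
(* [r] folds the copy of [D] back onto [D], and [q] numbers the quadrants, 0 being the old one; the
   tag [t (q x y)] keeps the images of the three new ones apart. *)
pose r x := if pselect (exists2 y, D y & hh y = x) is left e
  then s2val (cid2 e) else x.
have r1 x : D x -> r x = x.
  move=> Dx; rewrite /r; case: pselect => // e; case: (cid2 e) => y /= Dy yx.
  by case: (hhn _ Dy); rewrite yx.
have r2 x : D x -> r (hh x) = x.
  move=> Dx; rewrite /r; case: pselect => [e|]; last by case; exists x.
  by case: (cid2 e) => y /= Dy /hhi ->.
pose q x y := if pselect (D x) then if pselect (D y) then 0 else 1
              else if pselect (D y) then 2 else 3.
pose g x y := if q x y is 0 then f x y else hh (f (t (q x y)) (f (r x) (r y))).
have rD x : D2 x -> D (r x).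
  by move=> [Dx|[y Dy <-]]; [rewrite r1|rewrite r2].
have gE x y : D x -> D y -> g x y = f x y.
  by move=> Dx Dy; rewrite /g /q; do 2 case: pselect.
have gnE x y : D2 x -> D2 y -> ~ (D x /\ D y) ->
    g x y = hh (f (t (q x y)) (f (r x) (r y))).
  by move=> _ _; rewrite /g /q; do 2 case: pselect => //; tauto.
have okg : ok (D2, g).
  split => /=.
  - by move=> x /(Dn); left.
  - move=> x y Dx Dy; have [[dx dy]|nd] := pselect (D x /\ D y).
      by left; rewrite gE//; apply: (fD).
    rewrite gnE//; right; eexists; last by [].
    by do ?apply: (fD) => //; exact: rD.
  - move=> x y x' y' Dx Dy Dx' Dy'.
    have [[dx dy]|nd] := pselect (D x /\ D y);
    have [[dx' dy']|nd'] := pselect (D x' /\ D y').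
    + by rewrite !gE//; exact: (fi).
    + rewrite gE// gnE// => e; exfalso.
      have /= := fD _ _ dx dy; rewrite e; apply: hhn.
      by do ?apply: (fD) => //; exact: rD.
    + rewrite gnE// (gE x')// => e; exfalso.
      have /= := fD _ _ dx' dy'; rewrite -e; apply: hhn.
      by do ?apply: (fD) => //; exact: rD.
    + rewrite !gnE// => /hhi e.
      have {}e : f (t (q x y)) (f (r x) (r y)) =
                 f (t (q x' y')) (f (r x') (r y')).
        by apply: e; do ?apply: (fD) => //; exact: rD.
      have [eq1 eq2] : t (q x y) = t (q x' y') /\
                       f (r x) (r y) = f (r x') (r y').
        by apply: (fi) e => //; do ?apply: (fD) => //; exact: rD.
      have [rx ry] : r x = r x' /\ r y = r y'.
        by apply: (fi) eq2 => //; exact: rD.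
      have inj1 z z' : D2 z -> D2 z' -> r z = r z' -> (D z <-> D z') -> z = z'.
        move=> [Dz|[u Du <-]] [Dz'|[u' Du' <-]];
          rewrite ?(r1 _ Dz) ?(r1 _ Dz') ?(r2 _ Du) ?(r2 _ Du')//.
        * by move=> ? [/(_ Dz)/(hhn _ Du')].
        * by move=> ? [_ /(_ Dz')/(hhn _ Du)].
        * by move=> ->.
      have qq : q x y = q x' y' by apply: contrapT => /ti.
      by split; apply: inj1 => //; move: qq; rewrite /q;
        do 4 (case: pselect => ?).
have /fmax/asboolP[/= + _] : R (exist _ (D, f) (And3 Dn fD fi)) (exist _ (D2, g) okg).
  apply/asboolP; split => /= [z Dz|x y Dx Dy]; first by left.
  by rewrite gE.
(* By maximality [hh (t 0)] would have to lie in [D]. *)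
move=> /(_ (hh (t 0))) H; have := hhn _ (Dt 0); apply; apply: H.
by right; exists (t 0).
Qed.

(** Lists become nested pairs; the tags [n 0] and [n 1] separate the empty list from the others. *)
Lemma embeds_seq (X : Type) : embeds nat X -> embeds (seq X) X.
Proof.
move=> nX; have [f fi] := embeds_sqr nX; have [n ni] := nX.
pose fix c s := if s is x :: s' then f (n 1, f (x, c s')) else f (n 0, n 0).
exists c; elim=> [|x s IH] [|y s'] //= /fi [].
- by move/ni.
- by move/ni.
- by move=> /fi[-> /IH ->].
Qed.

Lemma embeds_option (X : Type) : embeds nat X -> embeds (option X) X.
Proof.
move=> nX; apply: embeds_trans (embeds_seq nX).
by exists (fun o => if o is Some x then [:: x] else [::]) => -[x|] [y|]// [->].
Qed.

Local Open Scope ring_scope.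

(** * Hamel bases *)

(** The map is total on [T] with values in [option U], as [U] may be empty. *)
Lemma card_leP_embeds T U (A : set T) (B : set U) :
  (A #<= B)%card <->
  exists f : T -> option U, {in A &, injective f} /\
    forall x, A x -> exists2 y, B y & f x = Some y.
Proof.
split.
- move=> /card_leP[f].
  exists (fun x => if pselect (A x) is left Ax
                   then Some (val (f (SigSub (mem_set Ax)))) else None).
  split.
    move=> x y /set_mem Ax /set_mem Ay; do 2 (case: pselect => // ?) => -[].
    move=> /val_inj/'inj_f; rewrite !inE => /(_ I I) e.
    by have := congr1 val e.
  move=> x Ax; case: pselect => // Ax'.
  by exists (val (f (SigSub (mem_set Ax')))) => //; exact: set_valP.
- move=> [f [fi fA]].
  suff : (A #<= some @` B)%card by rewrite card_le_some.
  have /card_esym := inj_card_eq fi; rewrite card_eq_le => /andP[+ _].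
  move=> AfA; apply: (card_le_trans AfA).
  by apply: subset_card_le => _ [x Ax <-]; have [y By ->] := fA _ Ax; exists y.
Qed.

Section Hamel.
Context d (T : measurableType d) (R : realType).
Variable mu : {measure set T -> \bar R}.
Variable K : fieldType.

Definition ae_independent (B : set (T -> K)) : Prop :=
  forall n (b : 'I_n -> T -> K) (c : 'I_n -> K),
    injective b -> (forall i, B (b i)) ->
    ae_eqK mu (fun x => \sum_(i < n) c i * b i x) (fun _ => 0) ->
    forall i, c i = 0.

(** The finite character behind the use of Zorn's lemma: finitely many points of the union of a
    chain lie in one member. The first alternative covers the empty chain. *)
Lemma total_on_fin_union (X : Type) (C : set (set X)) n (b : 'I_n -> X) (A0 : set X):
  total_on C subset -> 
  (forall i, (\bigcup_(A in C) A `|` A0) (b i)) ->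
  (forall i, A0 (b i)) \/ exists2 A, C A & forall i, (A `|` A0) (b i).
Proof.
move=> Ctot; elim: n b => [|n IH] b bC; first by left; case.
have [|H|[A CA HA]] := IH (fun i => b (lift ord0 i)).
- by move=> i; exact: bC.
- case: (bC ord0) => [[A CA bA]|b0].
  + right; exists A => // i; case: (unliftP ord0 i) => [j ->|->]; last by left.
    by right.
  + by left=> i; case: (unliftP ord0 i) => [j ->|->].
- right; case: (bC ord0) => [[A' CA' bA]|b0]; last first.
    by exists A => // i; case: (unliftP ord0 i) => [j ->|->]; [exact: HA|right].
  case: (Ctot _ _ CA CA') => AA'.
    exists A' => // i; case: (unliftP ord0 i) => [j ->|->]; last by left.
    by case: (HA j) => [/AA'|]; [left|right].
  exists A => // i; case: (unliftP ord0 i) => [j ->|->]; last by left; exact: AA'.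
  exact: HA.
Qed.

(** A maximal [B] with independent union with [B0] spans, since otherwise a vector outside the span
    could be added. Independence is asked of the union with [B0], so that the empty chain satisfies
    it too. *)
Lemma hamel_basis_extend (F B0 : set (T -> K)) :
  B0 `<=` F -> ae_independent B0 ->
  exists2 B, B0 `<=` B & hamel_basis mu F B.
Proof.
move=> B0F iB0.
have [C CP Ctot|B [[BF iB] Bmax]] := @Zorn_bigcup _ [set B | B `<=` F /\ ae_independent (B `|` B0)].
  split; first by move=> f [A /CP[AF _] /AF].
  move=> n b c bi bC.
  have [bB0|[A CA bA]] := total_on_fin_union Ctot bC; first exact: iB0.
  by case: (CP _ CA) => _; apply.
exists (B `|` B0); first by move=> f; right.
split => //; first by move=> f [/BF|/B0F].
move=> f Ff; apply: contrapT => nspan.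
have nBf : ~ (B `|` B0) f.
  move=> Bf; apply: nspan; exists 1%N, (fun=> f), (fun=> 1); split => //.
  by apply: aeW => x; rewrite big_ord_recr big_ord0 /= add0r mul1r.
apply: (Bmax (B `|` [set f])).
  split; first by move=> h; left.
  by move=> /(_ f (or_intror erefl)) Bf; apply: nBf; left.
split; first by move=> h [/BF|->].
move=> n b c bi bB sum0.
have [[i0 bi0]|nobf] := pselect (exists i, b i = f); last first.
  apply: iB sum0 => // i; case: (bB i) => [[|bf]|]; [by left| |by right].
  by case: nobf; exists i.
case: n => [|n] in b c bi bB sum0 i0 bi0 *; first by case: (i0).
have bB' j : (B `|` B0) (b (lift i0 j)).
  case: (bB (lift i0 j)) => [[|]|]; [by left| |by right].
  rewrite -bi0 => /bi/eqP; by rewrite eq_sym (negbTE (neq_lift _ _)).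
have sumE x : \sum_(i < n.+1) c i * b i x = 
    c i0 * f x + \sum_(j < n) c (lift i0 j) * b (lift i0 j) x.
  by rewrite (bigD1_ord i0)//= bi0.
(* If the coefficient of [f] vanishes, the relation is one among the old vectors; if not, it
   expresses [f] through them. *)
have [ci0|ci0] := eqVneq (c i0) 0.
  have cl : forall j, c (lift i0 j) = 0.
    apply: (iB _ (fun j => b (lift i0 j)) (fun j => c (lift i0 j))) => //.
      by move=> j k /bi/lift_inj.
    apply: filterS sum0 => x /=; by rewrite sumE ci0 mul0r add0r.
  by move=> i; case: (unliftP i0 i) => [j ->|->].
exfalso; apply: nspan.
exists n, (fun j => b (lift i0 j)), (fun j => - (c i0)^-1 * c (lift i0 j)).
split => //; apply: filterS sum0 => x; rewrite sumE => /eqP.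
rewrite addr_eq0 => /eqP e.
under eq_bigr do rewrite -mulrA.
rewrite -mulr_sumr -[X in _ * X]opprK -e mulrNN mulrA mulVf// mul1r//.
Qed.

(** Otherwise [1 * f - 1 * g = 0] is a nontrivial relation. Thus distinct members of a basis are
    distinct as classes, and counting functions counts classes. *)
Lemma ae_independent_inj B f g : ae_independent B -> B f -> B g ->
  ae_eqK mu f g -> f = g.
Proof.
move=> iB Bf Bg fg; apply: contrapT => nfg.
pose b (i : 'I_2) := if val i == 0%N then f else g.
pose c (i : 'I_2) : K := if val i == 0%N then 1 else - 1.
suff : c ord0 = 0 by apply/eqP; exact: oner_neq0.
apply: (iB _ b c).
- move=> i j; rewrite /b; case: i => -[|[|//]] ? //=; case: j => -[|[|//]] ? //=.
  + by move=> _; exact: val_inj.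
  + by move=> /esym.
  + by move=> _; exact: val_inj.
- by move=> i; rewrite /b; case: ifP.
- apply: filterS fg => x e.
  by rewrite !big_ord_recr big_ord0 /= /b /c /= add0r mul1r mulN1r e subrr.
Qed.

(* Every basis extending [range v] has cardinality [#V]: at most, by [code]. *)
Lemma same_dim_embeds (F E : set (T -> K)) (V : Type)
    (code : (T -> K) -> V) (v : V -> T -> K) :
  F `<=` E ->
  (forall f g, E f -> E g -> code f = code g -> ae_eqK mu f g) ->
  injective v -> range v `<=` F -> ae_independent (range v) ->
  same_dim mu F E.
Proof.
move=> FE codei vi vF iv.
have bound (G : set (T -> K)) : G `<=` E -> range v `<=` G ->
    exists2 B, hamel_basis mu G B & (B #= [set: V])%card.
  move=> GE vG; have [B vB hB] := hamel_basis_extend vG iv; exists B => //.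
  rewrite card_eq_le; apply/andP; split; apply/card_leP_embeds.
    case: hB => BG iB _.
    exists (Some \o code); split; last by move=> f _; exists (code f).
    move=> f g /set_mem Bf /set_mem Bg [] e; apply: (ae_independent_inj iB) => //.
    by apply: codei => //; apply/GE/BG.
  exists (Some \o v); split; first by move=> x y _ _ [] /vi.
  by move=> x _; exists (v x) => //; apply: vB; exists x.
have [BF hBF cF] := bound F FE vF.
have [BE hBE cE] := bound E (@subset_refl _ _) (subset_trans vF FE).
exists BF, BE; split => //.
by rewrite (card_eq_trans cF)// card_eq_sym.
Qed.
End Hamel.

(** * Integrals of powers *)

Lemma eseries_single (R : realType) (u : nat -> \bar R) k :
  (forall j, j <> k -> u j = 0%E) -> (\sum_(j <oo) u j = u k)%E.
Proof.
move=> u0; apply: lim_near_cst => //; exists k.+1 => // n /= kn.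
rewrite big_mkord (bigD1 (Ordinal kn))//= big1 ?adde0// => i ik.
by apply: u0 => e; move/eqP: ik; apply; exact: val_inj.
Qed.

Lemma series_half (R : realType) : (\sum_(k <oo) (1 / (2 ^ (k + 1))%:R)%:E = 1 :> \bar R)%E.
Proof.
have := @cvg_geometric_eseries_half R 1 0; rewrite expr0 divr1.
by move/cvg_lim => <-.
Qed.

Section PowerIntegral.
Context d (T : measurableType d) (R : realType).
Variable mu : {measure set T -> \bar R}.

Lemma ae_foralln (P : nat -> T -> Prop) :
  (forall n, {ae mu, forall x, P n x}) -> {ae mu, forall x, forall n, P n x}.
Proof.
move=> aeP.
have N : mu.-negligible (\bigcup_n ~` [set x | P n x]).
  by apply: negligible_bigcup => k; exact: aeP.
by apply: negligibleS N => x /= /existsNP[n nP]; exists n.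
Qed.

(** The [s]-th power of the [L_s] norm. Without the root it is additive over disjoint supports. *)
Definition pint (s : R) (f : T -> R) : \bar R := (\int[mu]_x (`|f x| `^ s)%:E)%E.

Lemma measurable_pint (s : R) (f : T -> R) : measurable_fun setT f ->
  measurable_fun setT (EFin \o (fun x => `|f x| `^ s)).
Proof.
move=> mf; apply/measurable_EFinP.
apply: (measurableT_comp (measurable_powR s)).
exact: measurableT_comp.
Qed.

Lemma pint_ge0 s f : (0 <= pint s f)%E.
Proof. by apply: integral_ge0 => x _; rewrite lee_fin powR_ge0. Qed.

Lemma inL_pint (s : R) (f : T -> R) : 0 < s ->
  inL mu (@Num.norm _ R) (@measR d T R) s f <->
  measurable_fun setT f /\ (pint s f < +oo)%E.
Proof.
move=> s0; rewrite /inL /finite_norm unlock.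
rewrite [X in (X `^ _)%E](_ : _ = pint s f); last first.
  by apply: eq_integral => x _ /=; rewrite normr_id.
split=> -[mf H]; split => //; last exact: poweR_lty.
by apply: lty_poweRy H; rewrite invr_eq0 gt_eqF.
Qed.

Lemma le_pint (s : R) (f g : T -> R) : measurable_fun setT f -> measurable_fun setT g -> 0 <= s ->
  {ae mu, forall x, `|f x| <= `|g x|} -> (pint s f <= pint s g)%E.
Proof.
move=> mf mg s0 fg; apply: ae_ge0_le_integral => //; try exact: measurable_pint.
apply: filterS fg => x fgx _; rewrite lee_fin.
by apply: ge0_ler_powR => //; rewrite nnegrE.
Qed.

Lemma eq_pint (s : R) (f g : T -> R) : measurable_fun setT f -> measurable_fun setT g -> 0 <= s ->
  {ae mu, forall x, f x = g x} -> pint s f = pint s g.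
Proof.
move=> mf mg s0 fg; apply/eqP; rewrite eq_le; apply/andP.
by split; apply: le_pint => //; apply: filterS fg => x ->.
Qed.

Lemma pintZ (s c : R) (f : T -> R) : measurable_fun setT f ->
  pint s (fun x => c * f x) = ((`|c| `^ s)%:E * pint s f)%E.
Proof.
move=> mf; rewrite /pint -ge0_integralZl//; last exact: measurable_pint.
by apply: eq_integral => x _; rewrite normrM powRM.
Qed.

Lemma pint0 s : 0 < s -> pint s (fun=> 0) = 0%E.
Proof.
move=> s0; rewrite /pint; under eq_integral do rewrite normr0 powR0 ?gt_eqF//.
by rewrite integral0.
Qed.

(** From [|f + g| <= 2 * max(|f|, |g|)]; no convexity is involved, so every [s >= 0] is allowed. *)
Lemma pintD (s : R) (f g : T -> R) : 0 <= s -> measurable_fun setT f -> measurable_fun setT g ->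
  (pint s (fun x => f x + g x)%R <= (2 `^ s)%:E * (pint s f + pint s g))%E.
Proof.
move=> s0 mf mg; rewrite -ge0_integralD//; try exact: measurable_pint.
have mfg := emeasurable_funD (measurable_pint s mf) (measurable_pint s mg).
rewrite -ge0_integralZl//; last by move=> x _; rewrite adde_ge0// lee_fin powR_ge0.
apply: ge0_le_integral => //.
- exact/measurable_pint/measurable_funD.
- exact: measurable_funeM.
- move=> x _; rewrite -EFinD -EFinM lee_fin.
  apply: (@le_trans _ _ ((2 * Num.max `|f x| `|g x|) `^ s)).
    apply: ge0_ler_powR; rewrite ?nnegrE// ?mulr_ge0// ?le_max ?normr_ge0//.
    rewrite (le_trans (ler_normD _ _))// mulr_natl mulr2n.
    by rewrite lerD// le_max lexx ?orbT.
  rewrite powRM ?le_max ?normr_ge0//.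
  rewrite ler_wpM2l ?powR_ge0//.
  case: (leP `|f x| `|g x|) => _; first by rewrite lerDr powR_ge0.
  by rewrite lerDl powR_ge0.
Qed.

(** The pointwise sum works: almost everywhere it has at most one nonzero term, so taking powers
    commutes with it, and monotone convergence integrates it term by term. *)
Lemma disjoint_glue (h : nat -> T -> R) :
  (forall k, measurable_fun setT (h k)) -> (forall k x, 0 <= h k x) ->
  (forall j k, j <> k -> {ae mu, forall x, h j x = 0 \/ h k x = 0}) ->
  exists f : T -> R, [/\ measurable_fun setT f, forall x, 0 <= f x,
    forall k, {ae mu, forall x, h k x <> 0 -> f x = h k x},
    forall x, (forall k, h k x = 0) -> f x = 0 &
    forall s, 0 < s -> pint s f = (\sum_(k <oo) pint s (h k))%E].
Proof.
move=> mh h0 hdisj.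
pose S x := (\sum_(k <oo) (h k x)%:E)%E.
have mS : measurable_fun setT S.
  by apply: ge0_emeasurable_sum => [k x _ _|k _]; [rewrite lee_fin|exact/measurable_EFinP].
(* An infinite sum can occur only on the null set where two supports meet; [fine] replaces it by
   0. *)
have mf : measurable_fun setT (fun x => fine (S x)) by exact: measurableT_comp.
have S0 x : (0 <= S x)%E by apply: nneseries_ge0 => k _ _; rewrite lee_fin.
have disj : {ae mu, forall x, forall j k, j <> k -> h j x = 0 \/ h k x = 0}.
  apply: ae_foralln => j; apply: ae_foralln => k.
  have [->|jk] := pselect (j = k); first by apply: aeW.
  by apply: filterS (hdisj _ _ jk) => x H _.
have f0 x : (forall k, h k x = 0) -> fine (S x) = 0.
  by move=> hx; rewrite /S (eseries_single (k := 0%N)) ?hx// => j _; rewrite hx.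
have fE x : (forall j k, j <> k -> h j x = 0 \/ h k x = 0) -> forall k, h k x <> 0 ->
    S x = (h k x)%:E.
  move=> dx k hk; rewrite /S (eseries_single (k := k))// => j jk.
  by case: (dx j k jk) => [->|/hk].
exists (fun x => fine (S x)); split => //.
- by move=> x; exact: fine_ge0.
- by move=> k; apply: filterS disj => x dx hk; rewrite (fE x dx k hk).
- move=> s s0; rewrite /pint -integral_nneseries//; last first.
    by move=> k; exact: measurable_pint.
  apply: ge0_ae_eq_integral => //.
  + exact: measurable_pint.
  + apply: ge0_emeasurable_sum => [k x _ _|k _]; first by rewrite lee_fin powR_ge0.
    exact: measurable_pint.
  + by move=> x _; apply: nneseries_ge0 => k _ _; rewrite lee_fin powR_ge0.
  + apply: filterS disj => x dx _.
    have [[k hk]|nk] := pselect (exists k, h k x <> 0).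
      rewrite (fE x dx k hk)/= (eseries_single (k := k))// => j jk.
      by case: (dx j k jk) => [->|/hk//]; rewrite normr0 powR0 ?gt_eqF.
    have hx k : h k x = 0 by apply: contrapT => hk; apply: nk; exists k.
    rewrite f0// (eseries_single (k := 0%N)) ?hx// => j _.
    by rewrite hx normr0 powR0 ?gt_eqF.
Qed.

End PowerIntegral.

(** * Bad functions on sets of infinite measure *)

Section Bad.
Context d (T : measurableType d) (R : realType).
Variables (mu : {measure set T -> \bar R}) (p : R).
Hypothesis p1 : 1 < p.

Definition bad (g : T -> R) : Prop :=
  [/\ measurable_fun setT g, forall x, 0 <= g x, (pint mu p g <= 1)%E &
      forall q, 1 <= q < p -> pint mu q g = +oo%E].

Lemma pint_indic (s : R) (C : set T) : 0 < s -> measurable C ->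
  pint mu s \1_C = mu C.
Proof.
move=> s0 mC; rewrite /pint -[in RHS](setIT C) -integral_indic//.
apply: eq_integral => x _; rewrite indicE; case: (_ \in _) => /=.
  by rewrite normr1 powR1.
by rewrite normr0 powR0// gt_eqF.
Qed.

(* [C k] carries the mass [2 ^ - (k + 1)] of [g ^ p], and the mass
   [X ^ (- th) * mu (C k) ^ (1 - th)] of [g ^ q], where [X = 2 ^ (k + 1)] and
   [th = q / p]; this is at least [X] for large [k] as soon as
   [mu (C k) >= X ^ k]. *)
Lemma bad_disjoint (C : nat -> set T) :
  (forall k, measurable (C k)) -> trivIset setT C ->
  (forall k, (mu (C k) < +oo)%E) ->
  (forall k, (((2 ^+ k.+1) ^+ k)%:E <= mu (C k))%E) ->
  exists2 g, bad g & forall x, g x <> 0 -> exists k, C k x.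
Proof.
move=> mC tC Cfin Cge.
have p0 : 0 < p by rewrite (lt_trans _ p1).
pose m k := fine (mu (C k)).
have mE k : mu (C k) = (m k)%:E by rewrite fineK// ge0_fin_numE// Cfin.
have mge k : (2 ^+ k.+1) ^+ k <= m k by rewrite -lee_fin -mE.
have m0 k : 0 < m k by rewrite (lt_le_trans _ (mge k))// !exprn_gt0.
(* Chosen so that [c k ^ p * m k = 2 ^ - (k + 1)]. *)
pose c k := ((2 ^+ k.+1)^-1 / m k) `^ p^-1.
have cs k s : 0 < s -> pint mu s (fun x => c k * \1_(C k) x) =
    (((2 ^+ k.+1)^-1 / m k) `^ (p^-1 * s) * m k)%:E.
  move=> s0; rewrite pintZ// pint_indic// mE -EFinM.
  by rewrite ger0_norm ?powR_ge0// -powRrM.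
have [|||f [mf f0 fE f_supp fint]] := @disjoint_glue _ _ _ mu
    (fun k x => c k * \1_(C k) x).
- by move=> k; exact: measurable_funM.
- by move=> k x; rewrite mulr_ge0// powR_ge0.
- move=> j k jk; apply: aeW => x.
  have [Cj|Cj] := pselect (C j x); last first.
    by left; rewrite indicE memNset// mulr0.
  right; rewrite indicE memNset ?mulr0// => Ck.
  by apply: jk; apply: tC => //; exists x.
exists f; last first.
  move=> x fx; apply: contrapT => nC; apply: fx; apply: f_supp => k.
  by rewrite indicE memNset ?mulr0// => Ck; apply: nC; exists k.
split => //.
  rewrite fint// (eq_eseriesr (g := fun k => (1 / (2 ^ (k + 1))%:R)%:E)); last first.
    move=> k _; rewrite cs// mulVf ?gt_eqF// powRr1 ?divr_ge0 ?invr_ge0 ?exprn_ge0 ?ltW//.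
    by rewrite divfK ?gt_eqF// natrX addn1 mul1r.
  by rewrite series_half.
move=> q /andP[q1 qp].
have q0 : 0 < q by rewrite (lt_le_trans _ q1).
have th0 : 0 < 1 - p^-1 * q by rewrite subr_gt0 mulrC ltr_pdivrMr// mul1r.
set th := p^-1 * q in th0.
apply/eqyP => A A0.
(* The first bound gives [A <= k <= X]; the second says [- th + k * (1 - th) >= 1], so that the
   power of [X] reached below is at least [X]. *)
pose k := Num.bound (Num.max A ((1 + th) / (1 - th))).
have /andP[Ak thk] : (A <= k%:R) && ((1 + th) / (1 - th) <= k%:R).
  rewrite -ge_max; apply/ltW/archi_boundP.
  by rewrite le_max (ltW A0).
pose X : R := 2 ^+ k.+1.
have X0 : 0 < X by rewrite exprn_gt0.
have X1 : 1 <= X by rewrite exprn_ege1// ler1n.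
have AX : A <= X.
  rewrite (le_trans Ak)// /X -natrX ler_nat ltnW//.
  by rewrite (leq_trans (ltn_expl k (isT : (1 < 2)%N)))// leq_exp2l.
apply: (@le_trans _ _ (pint mu q (fun x => c k * \1_(C k) x))); last first.
  apply: le_pint => //; [exact: measurable_funM|exact: ltW|].
  apply: filterS (fE k) => x H.
  have [->|/eqP hk] := eqVneq (c k * \1_(C k) x) 0; first by rewrite normr0.
  by rewrite H.
rewrite cs// lee_fin (le_trans AX)// -/X -/th.
have -> : (X^-1 / m k) `^ th * m k = X `^ (- th) * m k `^ (1 - th).
  rewrite -!powR_inv1 ?ltW// powRM ?powR_ge0// -!powRrM !mulN1r -mulrA.
  congr (_ * _); rewrite addrC powRD; last by apply/implyP => _; rewrite gt_eqF.
  by rewrite powRr1// ltW.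
apply: (@le_trans _ _ (X `^ (- th) * (X ^+ k) `^ (1 - th))); last first.
  rewrite ler_wpM2l ?powR_ge0//.
  apply: ge0_ler_powR; [exact: ltW| | |exact: mge].
    by rewrite nnegrE exprn_ge0// ltW.
  by rewrite nnegrE ltW.
rewrite -powR_mulrn ?(ltW X0)// -powRrM -powRD; last by apply/implyP => _; rewrite gt_eqF.
apply: (@le_trans _ _ (X `^ 1)); first by rewrite powRr1// ltW.
apply: ler_powR => //.
by move: thk; rewrite ler_pdivrMr//; lra.
Qed.

(** A subsequence of [U] has differences [C k] of measure at least [a k]. These disjoint sets are
    distributed over infinitely many sequences, and each sequence carries one bad function. *)
Lemma bad_family (U : nat -> set T) :
  (forall n, measurable (U n)) -> (forall n, (mu (U n) < +oo)%E) ->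
  nondecreasing_seq U -> mu (\bigcup_n U n) = +oo%E ->
  exists g : nat -> T -> R, [/\ forall j, bad (g j),
    forall j x, g j x <> 0 -> exists n, U n x &
    forall i j x, g i x <> 0 -> g j x <> 0 -> i = j].
Proof.
move=> mU Ufin Uincr Uinf.
pose a k : R := (2 ^+ k.+1) ^+ k.
have a_homo k l : (k <= l)%N -> a k <= a l.
  move=> kl; rewrite /a -!exprM ler_weXn2l ?ler1n// leq_mul//.
have step n k : exists l, (n < l)%N /\ ((a k)%:E <= mu (U l `\` U n))%E.
  have : mu \o U @ \oo --> mu (\bigcup_n U n).
    by apply: nondecreasing_cvg_mu => //; exact: bigcupT_measurable.
  rewrite Uinf => /cvgeyPge /(_ (a k + fine (mu (U n)))) [N _ HN].
  exists (maxn N n.+1); split; first by rewrite leq_max ltnSn orbT.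
  rewrite measureD//; last exact: Ufin.
  have Unl : U n `<=` U (maxn N n.+1).
    by apply/subsetPset/Uincr; rewrite leq_max leqnSn orbT.
  rewrite setIC setIidl// leeBrDr ?ge0_fin_numE ?Ufin//.
  apply: le_trans (HN _ (leq_maxl _ _)).
  by rewrite EFinD fineK// ge0_fin_numE// Ufin.
have [s sP] := choice (fun nk : nat * nat => step nk.1 nk.2).
pose fix idx k := if k is k'.+1 then s (idx k', k') else 0%N.
pose C k := U (idx k.+1) `\` U (idx k).
have mC k : measurable (C k) by exact: measurableD.
have idxS k : (idx k < idx k.+1)%N by have [] := sP (idx k, k).
have Cge k : ((a k)%:E <= mu (C k))%E by have [] := sP (idx k, k).
have idx_homo : {homo idx : x y / (x <= y)%N >-> (x <= y)%N}.
  by apply: homo_leq => // [n m l|i]; [exact: leq_trans|exact: ltnW].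
have Cdisj i j x : C i x -> C j x -> i = j.
  wlog ij : i j / (i <= j)%N.
    by move=> H Ci Cj; case: (leqP i j) => [|/ltnW] ij; [|apply/esym]; apply: H ij _ _.
  move: ij; rewrite leq_eqVlt => /predU1P[//|ij] [Ci _] [_]; case.
  by apply: (subsetPset _ _ (Uincr _ _ (idx_homo _ _ ij))).
(* An injective pairing with [e j k >= k]: since [a] is nondecreasing, the [k]-th set of each
   sequence is still large enough. *)
pose e j k := ((j + k) ^ 2 + k)%N.
have e_inj j k j' k' : e j k = e j' k' -> j = j' /\ k = k'.
  rewrite /e => ee; have jk : (j + k = j' + k')%N by nia.
  by move: ee; rewrite jk; lia.
have ex j : exists2 g, bad g & forall x, g x <> 0 -> exists k, C (e j k) x.
  apply: (bad_disjoint (C := fun k => C (e j k))) => //.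
  - by move=> i k _ _ [x [Ci Ck]]; have [] := e_inj _ _ _ _ (Cdisj _ _ _ Ci Ck).
  - move=> k; apply: le_lt_trans (Ufin (idx (e j k).+1)).
    by apply: le_measure; rewrite ?inE//; exact: subDsetl.
  - move=> k; apply: le_trans (Cge _); rewrite lee_fin; apply: a_homo.
    by rewrite /e leq_addl.
have [g gP] := choice (fun j => let: ex_intro2 g gb gs := ex j in
  ex_intro (fun g => bad g /\ forall x, g x <> 0 -> exists k, C (e j k) x)
    g (conj gb gs)).
exists g; split.
- by move=> j; case: (gP j).
- move=> j x gx; have [_ /(_ x gx)[k [Ck _]]] := gP j.
  by exists (idx (e j k).+1).
- move=> i j x gi gj; have [_ /(_ x gi)[k Ck]] := gP i.
  have [_ /(_ x gj)[k' Ck']] := gP j.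
  by have [] := e_inj _ _ _ _ (Cdisj _ _ _ Ck Ck').
Qed.
End Bad.

(** * Almost everywhere convergence and level sets in [L_p] *)

Section Lp.
Context d (T : measurableType d) (R : realType).
Variables (mu : {measure set T -> \bar R}) (p : R).
Hypothesis p1 : 1 < p.

Let p0 : 0 < p. Proof. by rewrite (lt_trans _ p1). Qed.

(** The sum of the [|u n| ^ p] has integral at most 1, hence is finite almost everywhere, and its
    terms tend to 0 there. *)
Lemma summable_pint_cvg0 (u : nat -> T -> R) :
  (forall n, measurable_fun setT (u n)) ->
  (forall n, (pint mu p (u n) <= (1 / (2 ^ (n + 1))%:R)%:E)%E) ->
  {ae mu, forall x, u n x @[n --> \oo] --> 0}.
Proof.
move=> mu_ ule.
pose S x := (\sum_(n <oo) (`|u n x| `^ p)%:E)%E.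
have mS : measurable_fun setT S.
  apply: ge0_emeasurable_sum => [k x _ _|k _]; first by rewrite lee_fin powR_ge0.
  exact: measurable_pint.
have S0 x : (0 <= S x)%E by apply: nneseries_ge0 => k _ _; rewrite lee_fin powR_ge0.
have intS : (\int[mu]_x S x < +oo)%E.
  rewrite integral_nneseries//; last by move=> n; exact: measurable_pint.
  apply: le_lt_trans (ltry 1); rewrite -series_half.
  by apply: lee_nneseries => [n _ _|n _]; [exact: pint_ge0|exact: ule].
have iS : mu.-integrable setT S.
  apply/integrableP; split => //.
  by under eq_integral do rewrite gee0_abs//.
apply: filterS (integrable_ae measurableT iS) => x /(_ I) Sx.
pose a n : R := `|u n x| `^ p.
have ca : cvgn (series a).
  apply: nondecreasing_is_cvgn.
    by apply: nondecreasing_series => n _ _; exact: powR_ge0.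
  exists (fine (S x)) => _ [n _ <-].
  rewrite -lee_fin fineK// /series/= -sumEFin.
  by apply: nneseries_lim_ge => k _ _; rewrite lee_fin powR_ge0.
have /cvgrPdist_lt a0 := cvg_series_cvg_0 ca.
apply/cvgrPdist_lt => e e0; have := a0 (e `^ p) (powR_gt0 _ e0).
apply: filterS => n; rewrite !sub0r !normrN /a ger0_norm ?powR_ge0//.
rewrite !ltNge; apply: contra => eu; apply: ge0_ler_powR => //; first exact: ltW.
by rewrite nnegrE ltW.
Qed.

(** Chebyshev's inequality: [a * \1_A] is dominated by [f]. *)
Lemma level_fin (f : T -> R) (A : set T) (a : R) : measurable_fun setT f ->
  (pint mu p f < +oo)%E -> measurable A -> 0 < a -> (forall x, A x -> a <= `|f x|) ->
  (mu A < +oo)%E.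
Proof.
move=> mf fp mA a0 Af; rewrite ltNge leye_eq; apply/negP => /eqP muA.
move: fp; rewrite ltNge leye_eq => /negP; apply; rewrite -leye_eq.
apply: (@le_trans _ _ (pint mu p (fun x => a * \1_A x))).
  by rewrite pintZ// pint_indic// muA gt0_muley// lte_fin powR_gt0// normr_gt0 gt_eqF.
apply: le_pint => //; [exact: measurable_funM|exact: ltW|apply: aeW => x].
have [Ax|Ax] := pselect (A x).
  by rewrite indicE mem_set// mulr1 gtr0_norm// Af.
by rewrite indicE memNset// mulr0 normr0.
Qed.

Lemma msim_ae (A B : set T) : measurable A -> measurable B -> msim mu A B ->
  {ae mu, forall x, A x <-> B x}.
Proof.
move=> mA mB AB; exists ((A `\` B) `|` (B `\` A)); split => //.
  by apply: measurableU; exact: measurableD.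
move=> x /= nAB; have [Ax|Ax] := pselect (A x); have [Bx|Bx] := pselect (B x).
- by case: nAB.
- by left.
- by right.
- by case: nAB.
Qed.

Lemma measurable_support (f : T -> R) : measurable_fun setT f ->
  measurable [set x | f x <> 0].
Proof.
move=> mf; rewrite -[X in measurable X]setTI.
by apply: (mf measurableT [set~ 0]); exact: measurableC.
Qed.

Lemma ae_and (P Q : T -> Prop) : {ae mu, forall x, P x} ->
  {ae mu, forall x, Q x} -> {ae mu, forall x, P x /\ Q x}.
Proof. by move=> aP aQ; apply: filterS2 aP aQ => x. Qed.

(** * The closed span of a disjoint family of bad functions *)

Section Family.
Variables (G : Type) (g : G -> T -> R).
Hypothesis g_bad : forall c, bad mu p (g c).
Hypothesis g_disj : forall c e, c <> e -> {ae mu, forall x, g c x = 0 \/ g e x = 0}.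

(* The closed span of the [g c], described without infinite sums. *)
Definition span_family : set (T -> R) := [set f |
  [/\ measurable_fun setT f, (pint mu p f < +oo)%E,
      forall c, exists a, {ae mu, forall x, g c x <> 0 -> f x = a * g c x} &
      forall A, measurable A -> (forall c, {ae mu, forall x, A x -> g c x = 0}) ->
        {ae mu, forall x, A x -> f x = 0}]].

Lemma span_family0 : span_family (fun=> 0).
Proof.
split => //; first by rewrite pint0 ?ltry.
- by move=> c; exists 0; apply: aeW => x; rewrite mul0r.
- by move=> A _ _; apply: aeW.
Qed.

Lemma span_familyD f h : span_family f -> span_family h ->
  span_family (fun x => f x + h x).
Proof.
move=> [mf fp fa f0] [mh hp ha h0]; split.
- exact: measurable_funD.
- apply: le_lt_trans (pintD _ (ltW p0) mf mh) _.
  move: (2 `^ p) (powR_ge0 2 p) => k k0.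
  apply: lte_mul_pinfty; [by rewrite lee_fin|by []|].
  by apply: lte_add_pinfty; [exact: fp|exact: hp].
- move=> c; have [a fac] := fa c; have [b hbc] := ha c; exists (a + b).
  apply: filterS2 fac hbc => x Hf Hh gx.
  by rewrite Hf// Hh// mulrDl.
- move=> A mA gA; apply: filterS2 (f0 A mA gA) (h0 A mA gA) => x Hf Hh Ax.
  by rewrite Hf// Hh// addr0.
Qed.

Lemma span_familyZ c f : span_family f -> span_family (fun x => c * f x).
Proof.
move=> [mf fp fa f0]; split.
- exact: measurable_funM.
- by rewrite pintZ// lte_mul_pinfty// lee_fin powR_ge0.
- move=> e; have [a fae] := fa e; exists (c * a).
  by apply: filterS fae => x Hf gx; rewrite Hf// mulrA.
- move=> A mA gA; apply: filterS (f0 A mA gA) => x Hf Ax.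
  by rewrite Hf// mulr0.
Qed.

Lemma span_family_ae f h : span_family f -> measurable_fun setT h ->
  {ae mu, forall x, f x = h x} -> span_family h.
Proof.
move=> [mf fp fa f0] mh fh; split.
- exact: mh.
- by rewrite -(eq_pint mf mh (ltW p0) fh).
- move=> c; have [a fac] := fa c; exists a.
  by apply: filterS2 fac fh => x Hf <-.
- by move=> A mA gA; apply: filterS2 (f0 A mA gA) fh => x Hf <-.
Qed.

(** The integral for [q = 1] is infinite, so the support of [g c] is not null. This allows almost
    everywhere identities to be evaluated at a point where [g c] does not vanish. *)
Lemma bad_nonzero c (P : T -> Prop) : {ae mu, forall x, P x} ->
  exists2 x, P x & g c x <> 0.
Proof.
move=> aeP; apply: contrapT => nx.
have g0 : {ae mu, forall x, g c x = 0}.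
  apply: filterS aeP => x Px; apply: contrapT => gx; by apply: nx; exists x.
have [mg _ _ /(_ 1)] := g_bad c.
rewrite lexx p1 => /(_ isT).
have m0 : measurable_fun setT (fun _ : T => 0 : R) by exact: measurable_cst.
by rewrite (eq_pint mg m0 ler01 g0) pint0.
Qed.

(** Approximation at the summable rate [2 ^ - (n + 1)] forces convergence almost everywhere, under
    which both defining conditions of the span pass to the limit. *)
Lemma span_family_closed h : measurable_fun setT h -> (pint mu p h < +oo)%E ->
  (forall n, exists f, span_family f /\
    (pint mu p (fun x => f x - h x)%R <= (1 / (2 ^ (n + 1))%:R)%:E)%E) ->
  span_family h.
Proof.
move=> mh hp /choice[f ffh].
have fF n := (ffh n).1; have fh n := (ffh n).2.
have mf n : measurable_fun setT (f n) by case: (fF n).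
have cf : {ae mu, forall x, f n x @[n --> \oo] --> h x}.
  have := @summable_pint_cvg0 (fun n x => f n x - h x) _ fh.
  move=> /(_ (fun n => measurable_funB (mf n) mh)); apply: filterS => x cx.
  by apply/subr_cvg0.
split => //.
- move=> c.
  have /choice[a fa] : forall n, exists a,
      {ae mu, forall x, g c x <> 0 -> f n x = a * g c x}.
    by move=> n; case: (fF n).
  have good := ae_and cf (ae_foralln fa).
  (* A single good point of the support of [g c] determines all coefficients [a n], hence also their
     limit. *)
  have [x0 [cx0 fx0] gx0] := bad_nonzero c good.
  have ca : a n @[n --> \oo] --> h x0 / g c x0.
    rewrite (_ : a = fun n => f n x0 / g c x0); first exact: cvgMl.
    by apply: funext => n; rewrite fx0// mulfK//; apply/eqP.
  exists (h x0 / g c x0); apply: filterS good => x [cx fx] gx.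
  apply: (cvg_unique _ cx) => //.
  rewrite (_ : (f^~ x) = fun n => a n * g c x); first exact: cvgMl.
  by apply: funext => n; rewrite fx.
- move=> A mA gA.
  have f0 : {ae mu, forall x, forall n, A x -> f n x = 0}.
    by apply: ae_foralln => n; case: (fF n) => _ _ _; apply.
  apply: filterS2 cf f0 => x cx fx Ax.
  apply: (cvg_unique _ cx) => //.
  rewrite (_ : (f^~ x) = fun=> 0); first exact: cvg_cst.
  by apply: funext => n; rewrite fx.
Qed.

(** With a nonzero coefficient [a] at [c], [|f|] dominates [|a * g c|]. If all coefficients vanish,
    the last clause of [span_family], applied to the support of [f], gives [f = 0]. *)
Lemma span_family_bad f : span_family f -> {ae mu, forall x, f x = 0} \/
  forall q, 1 <= q < p -> pint mu q f = +oo%E.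
Proof.
move=> [mf fp fa f0].
have [[c [a [a0 fac]]]|na] := pselect (exists c a, a <> 0 /\
    {ae mu, forall x, g c x <> 0 -> f x = a * g c x}).
  right=> q qp; have [mg _ _ /(_ q qp) gq] := g_bad c.
  have q0 : 0 < q by case/andP: qp => q1 _; rewrite (lt_le_trans _ q1).
  apply/eqP; rewrite -leye_eq.
  apply: (@le_trans _ _ (pint mu q (fun x => a * g c x))).
    rewrite pintZ// gq gt0_muley// lte_fin powR_gt0// normr_gt0; exact/eqP.
  apply: le_pint => //; [exact: measurable_funM|exact: ltW|].
  apply: filterS fac => x fx; have [->|/eqP gx] := eqVneq (g c x) 0.
    by rewrite mulr0 normr0.
  by rewrite fx.
left.
have /(f0 _ (measurable_support mf)) :
    forall c, {ae mu, forall x, [set x | f x <> 0] x -> g c x = 0}.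
  move=> c; have [a fac] := fa c.
  have [a0|/eqP a0] := eqVneq a 0; last by case: na; exists c, a.
  apply: filterS fac => x fx /= nfx; apply: contrapT => gx; apply: nfx.
  by rewrite fx// a0 mul0r.
by apply: filterS => x /= H; apply: contrapT => fx; apply: (fx); exact: H.
Qed.

(** The [p]-th root of [2 ^ - (n + 1)]: the [p]-th powers sum to 1. *)
Definition coef n : R := (1 / (2 ^ (n + 1))%:R) `^ p^-1.

Lemma coef_gt0 n : 0 < coef n.
Proof. by rewrite powR_gt0// divr_gt0// ltr0n expn_gt0. Qed.

(** The element is the sum of the [coef n * g (s n)], glued along their disjoint supports; its
    [pint] is at most the sum of the [2 ^ - (n + 1)]. *)
Lemma span_family_seq (s : nat -> G) : injective s ->
  exists v, [/\ span_family v,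
    forall n, {ae mu, forall x, g (s n) x <> 0 -> v x = coef n * g (s n) x} &
    forall c, (forall n, s n <> c) -> {ae mu, forall x, g c x <> 0 -> v x = 0}].
Proof.
move=> si.
have mg c : measurable_fun setT (g c) by case: (g_bad c).
have [|||v [mv v0 vE vs vint]] := @disjoint_glue _ _ _ mu
    (fun n x => coef n * g (s n) x).
- by move=> n; exact: measurable_funM.
- by move=> n x; rewrite mulr_ge0// ?(ltW (coef_gt0 _))//; case: (g_bad (s n)).
- move=> j k jk; have /g_disj : s j <> s k by move=> /si.
  by apply: filterS => x [->|->]; rewrite mulr0; [left|right].
have coefN n x : g (s n) x <> 0 -> coef n * g (s n) x <> 0.
  by move=> /eqP gx; apply/eqP; rewrite mulf_neq0// gt_eqF// coef_gt0.
have vE' n : {ae mu, forall x, g (s n) x <> 0 -> v x = coef n * g (s n) x}.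
  by apply: filterS (vE n) => x + gx; apply; exact: coefN.
have vn c : (forall n, s n <> c) -> {ae mu, forall x, g c x <> 0 -> v x = 0}.
  move=> sc; have : {ae mu, forall x, forall n, g (s n) x = 0 \/ g c x = 0}.
    by apply: ae_foralln => n; exact/g_disj/sc.
  apply: filterS => x gx gc; apply: vs => n.
  by case: (gx n) => [->|/gc//]; rewrite mulr0.
exists v; split => //; split => //.
- rewrite vint//; apply: le_lt_trans (ltry 1); rewrite -series_half.
  apply: lee_nneseries => [n _ _|n _]; first exact: pint_ge0.
  rewrite pintZ//; case: (g_bad (s n)) => _ _ gp _.
  rewrite ger0_norm ?(ltW (coef_gt0 _))//.
  rewrite /coef -powRrM mulVf ?gt_eqF// powRr1 ?divr_ge0//.
  by rewrite -[leRHS]mule1; apply: lee_wpmul2l => //; rewrite lee_fin divr_ge0.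
- move=> c; have [[n <-]|nc] := pselect (exists n, s n = c).
    by exists (coef n).
  exists 0; have /vn : forall n, s n <> c by move=> n e; apply: nc; exists n.
  by apply: filterS => x H gx; rewrite mul0r H.
- move=> A mA gA; apply: filterS (ae_foralln (fun n => gA (s n))) => x gx Ax.
  by apply: vs => n; rewrite gx// mulr0.
Qed.

Hypothesis natG : embeds nat G.

(* Tree coding: distinct branches [s] share only finitely many prefixes, so
   each [v s] has a term which the finitely many others do not see. *)
Lemma span_family_independent : exists v : (nat -> G) -> T -> R,
  (forall s, span_family (v s)) /\
  forall n (s : 'I_n -> nat -> G) (a : 'I_n -> R), injective s ->
    {ae mu, forall x, \sum_(i < n) a i * v (s i) x = 0} -> forall i, a i = 0.
Proof.
have [code codei] := embeds_seq natG.
pose node (s : nat -> G) n := code (mkseq s n).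
have nodei s n s' n' : node s n = node s' n' -> n = n' /\ forall k, (k < n)%N -> s k = s' k.
  move=> /codei e; have := congr1 size e; rewrite !size_mkseq => nn'; split => // k kn.
  have := congr1 (fun t => nth (s 0%N) t k) e.
  by rewrite !nth_mkseq// -nn'.
have /choice[v vP] : forall s, exists v, [/\ span_family v,
    forall n, {ae mu, forall x, g (node s n) x <> 0 -> v x = coef n * g (node s n) x} &
    forall c, (forall n, node s n <> c) -> {ae mu, forall x, g c x <> 0 -> v x = 0}].
  by move=> s; apply: span_family_seq => n n' /nodei[].
exists v; split; first by move=> s; case: (vP s).
move=> n s a si sum0 i.
(* Every other branch has left [s i] before depth [N], so the node of [s i] at depth [N] belongs to
   no other branch. *)
have [N NP] : exists N, forall j, j != i -> exists2 k, (k < N)%N & s i k <> s j k.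
  have /choice[k kP] : forall j, exists k, j != i -> s i k <> s j k.
    move=> j; have [->|ji] := eqVneq j i; first by exists 0%N.
    apply: contrapT => nk; move/eqP: ji; apply; apply: si; apply: funext => k.
    by apply: contrapT => e; apply: nk; exists k => _ e'; apply: e.
  exists (\max_j k j).+1 => j ji; exists (k j); last exact: kP.
  by rewrite ltnS leq_bigmax.
have vi : {ae mu, forall x, g (node (s i) N) x <> 0 ->
    v (s i) x = coef N * g (node (s i) N) x} by case: (vP (s i)).
have vj : {ae mu, forall x, forall j, j != i -> g (node (s i) N) x <> 0 -> v (s j) x = 0}.
  have H (j : 'I_n) : {ae mu, forall x, j != i -> g (node (s i) N) x <> 0 -> v (s j) x = 0}.
    have [->|ji] := eqVneq j i; first by apply: aeW.
    have [_ _ /(_ (node (s i) N))] := vP (s j).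
    move=> /(_ _); have ne m : node (s j) m <> node (s i) N.
      move=> e; have [mN eqk] := nodei _ _ _ _ e.
      by have [k kN] := NP j ji; apply; rewrite eqk// mN.
    by move=> /(_ ne); apply: filterS => x + _.
  (* [insubd i] extends the finite index set to [nat]; its default [i] makes the extra statements
     vacuous. *)
  have := ae_foralln (fun m => H (insubd i m)).
  by apply: filterS => x Hx j; have := Hx (val j); rewrite valKd.
have [x [[sx vix] vjx] gx] := bad_nonzero (node (s i) N) (ae_and (ae_and sum0 vi) vj).
move: sx; rewrite /= (bigD1 i)//= big1 => [|j ji]; last first.
  by rewrite vjx// mulr0.
rewrite addr0 vix// => /eqP; rewrite !mulf_eq0 => /orP[/eqP//|/orP[|]].
  by rewrite gt_eqF// coef_gt0.
by move=> /eqP.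
Qed.

End Family.

(** A function is determined by its sets above positive and below negative rational thresholds.
    Avoiding the threshold 0 makes these sets of finite measure, so [j] can code them. *)
Lemma Lp_code (V : Type) (j : set T -> V) :
  (forall A B, Sfin mu A -> Sfin mu B -> j A = j B -> msim mu A B) ->
  exists c : (T -> R) -> nat -> V, forall f h : T -> R,
    measurable_fun setT f -> (pint mu p f < +oo)%E ->
    measurable_fun setT h -> (pint mu p h < +oo)%E ->
    c f = c h -> {ae mu, forall x, f x = h x}.
Proof.
move=> jP.
pose level (f : T -> R) (q : rat) : set T := if 0 < q then f @^-1` `]ratr q, +oo[
  else if q < 0 then f @^-1` `]-oo, ratr q[ else set0.
have level_Sfin f q : measurable_fun setT f -> (pint mu p f < +oo)%E ->
    Sfin mu (level f q).
  move=> mf fp; rewrite /level; case: ltP => q0; [|case: ltP => q0'].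
  - have mA : measurable (f @^-1` `]ratr q, +oo[).
      by rewrite -[X in measurable X]setTI; exact: mf.
    split => //; apply: (level_fin mf fp mA (a := ratr q)); first by rewrite ltr0q.
    move=> x /=; rewrite in_itv/= andbT => /ltW qx; exact: le_trans (ler_norm _).
  - have mA : measurable (f @^-1` `]-oo, ratr q[).
      by rewrite -[X in measurable X]setTI; exact: mf.
    split => //; apply: (level_fin mf fp mA (a := - ratr q)).
      by rewrite oppr_gt0 ltrq0.
    move=> x /=; rewrite in_itv/= => /ltW xq.
    by rewrite -normrN; apply: le_trans (ler_norm _); rewrite lerN2.
  - by split => //; rewrite measure0.
exists (fun f n => j (level f (odflt 0 (unpickle n)))) => f h mf fp mh hp e.
have ms q : {ae mu, forall x, level f q x <-> level h q x}.
  have [mA _] := level_Sfin f q mf fp; have [mB _] := level_Sfin h q mh hp.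
  apply: msim_ae => //; apply: jP; try exact: level_Sfin.
  by have := congr1 (fun u => u (pickle q)) e; rewrite pickleK.
have : {ae mu, forall x, forall q, level f q x <-> level h q x}.
  have := ae_foralln (fun n => ms (odflt 0 (unpickle n))).
  by apply: filterS => x H q; have := H (pickle q); rewrite pickleK.
apply: filterS => x.
(* two distinct values are separated by a nonzero rational *)
suff sep (f' h' : T -> R) : (forall q, level f' q x <-> level h' q x) -> f' x <= h' x.
  by move=> H; apply/eqP; rewrite eq_le sep// sep// => q; split=> /H.
move=> H; rewrite leNgt; apply/negP => hf.
have [h0|h0] := leP 0 (h' x).
  have [q] := rat_in_itvoo hf; rewrite in_itv/= => /andP[hq qf].
  have q0 : 0 < q by rewrite -(ltr0q R) (le_lt_trans h0).
  have := H q; rewrite /level q0 /= !in_itv/= !andbT => -[/(_ qf)].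
  by rewrite ltNge (ltW hq).
have [q] : exists q : rat, ratr q \in `]h' x, Num.min (f' x) 0[.
  by apply: rat_in_itvoo; rewrite lt_min hf h0.
rewrite in_itv/= lt_min => /and3P[hq qf]; rewrite ltrq0 => q0.
have := H q; rewrite /level ltNge (ltW q0)/= q0 /= !in_itv/= => -[_ /(_ hq)].
by rewrite ltNge (ltW qf).
Qed.

End Lp.

(** * The closed span in both scalar fields *)

Section Spaceable.
Context d (T : measurableType d) (R : realType).
Variables (mu : {measure set T -> \bar R}) (p : R).
Hypothesis p1 : 1 < p.

Let p0 : 0 < p. Proof. by rewrite (lt_trans _ p1). Qed.

(** Turns a distance bound into the summable rate required by [span_family_closed]. *)
Lemma Ldist_lt_pint (K : fieldType) (absK : K -> R) (f g : T -> K) n :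
  (Ldist mu absK p f g < (coef p n)%:E)%E ->
  (pint mu p (fun x => absK (f x - g x)%R) <= (1 / (2 ^ (n + 1))%:R)%:E)%E.
Proof.
rewrite /Ldist unlock.
rewrite [X in (X `^ _)%E](_ : _ = pint mu p (fun x => absK (f x - g x)))//.
have := pint_ge0 mu p (fun x => absK (f x - g x)).
case: (pint _ _ _) => [r|_|//]; last by rewrite poweRyr// invr_eq0 gt_eqF.
rewrite lee_fin poweR_EFin lte_fin lee_fin => r0 /ltW H.
have := ge0_ler_powR (ltW p0) _ _ H.
rewrite /coef -!powRrM mulVf ?gt_eqF// !powRr1 ?divr_ge0//.
by apply; rewrite nnegrE powR_ge0.
Qed.

Variables (G : Type) (g : G -> T -> R) (j : set T -> nat -> G).
Hypothesis g_bad : forall c, bad mu p (g c).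
Hypothesis g_disj : forall c e, c <> e -> {ae mu, forall x, g c x = 0 \/ g e x = 0}.
Hypothesis natG : embeds nat G.
Hypothesis j_inj : forall A B, Sfin mu A -> Sfin mu B -> j A = j B -> msim mu A B.

Let F := span_family mu p g.

Lemma Lp_code_nat : exists c : (T -> R) -> nat -> G, forall f h : T -> R,
    measurable_fun setT f -> (pint mu p f < +oo)%E ->
    measurable_fun setT h -> (pint mu p h < +oo)%E ->
    c f = c h -> {ae mu, forall x, f x = h x}.
Proof.
have [c cP] := Lp_code p1 j_inj; have [k ki] := embeds_nat2 G.
exists (k \o c) => f h mf fp mh hp /ki; exact: cP.
Qed.

(** Injectivity follows from independence: [v s = v s'] with [s <> s'] would give the relation
    [v s - v s' = 0]. *)
Lemma span_family_basis : exists v : (nat -> G) -> T -> R,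
  [/\ injective v, forall s, F (v s) &
  forall n (s : 'I_n -> nat -> G) (a : 'I_n -> R), injective s ->
    {ae mu, forall x, \sum_(i < n) a i * v (s i) x = 0} -> forall i, a i = 0].
Proof.
have [v [vF vi]] := span_family_independent p1 g_bad g_disj natG.
exists v; split => // s s' ss'; apply: contrapT => nss'.
pose t (i : 'I_2) := if val i == 0%N then s else s'.
pose a (i : 'I_2) : R := if val i == 0%N then 1 else - 1.
suff : a ord0 = 0 by apply/eqP; exact: oner_neq0.
apply: (vi _ t a) => [i k|].
  rewrite /t; case: i => -[|[|//]] ? //=; case: k => -[|[|//]] ? //=.
  + by move=> _; exact: val_inj.
  + by move=> /esym.
  + by move=> _; exact: val_inj.
apply: aeW => x.
by rewrite !big_ord_recr big_ord0 /= /t /a /= add0r mul1r mulN1r ss' subrr.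
Qed.

Lemma spaceable_real :
  Lp_minus_Lq_maximal_spaceable mu (@Num.norm _ R) (@measR d T R) p.
Proof.
have FL : F `<=` inL mu (@Num.norm _ R) (@measR d T R) p.
  by move=> f [mf fp _ _]; apply/inL_pint.
exists F; split.
- split => //.
  + by move=> f h Ff /(inL_pint _ _ p0)[mh _]; exact: span_family_ae.
  + exact: span_family0.
  + exact: span_familyD.
  + exact: span_familyZ.
- move=> h /(inL_pint _ _ p0)[mh hp] H.
  apply: span_family_closed => // n.
  have [f [Ff /Ldist_lt_pint fh]] := H _ (coef_gt0 p n).
  exists f; split; [exact: Ff|apply: le_trans fh].
  have mfh : measurable_fun setT (fun x => f x - h x).
    by case: Ff => mf _ _ _; exact: measurable_funB.
  apply: le_pint => //; [exact: measurableT_comp|exact: ltW|].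
  by apply: aeW => x; rewrite normr_id.
(* The family [v] and the code [c] bound both dimensions by the cardinal of [nat -> G], from below
   and from above. *)
- have [c cP] := Lp_code_nat; have [v [vi vF v_ind]] := span_family_basis.
  apply: (same_dim_embeds (code := c) (v := v)) => //.
  + by move=> f h /(inL_pint _ _ p0)[mf fp] /(inL_pint _ _ p0)[mh hp]; exact: cP.
  + by move=> _ [s _ <-].
  + move=> n b a bi bv sum0.
    have /choice[s sb] : forall i, exists s, v s = b i.
      by move=> i; have [s _ <-] := bv i; exists s.
    apply: (v_ind _ s) => [i k e|]; first by apply: bi; rewrite -!sb e.
    by apply: filterS sum0 => x e; rewrite -[RHS]e; apply: eq_bigr => i _; rewrite sb.
- move=> f /(span_family_bad g_bad)[f0|fq]; [by left|right => q q1p].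
  have q0 : 0 < q by case/andP: q1p => q1 _; rewrite (lt_le_trans _ q1).
  by move=> /(inL_pint _ _ q0)[_]; rewrite fq.
Qed.

(** * Reduction of complex scalars to real and imaginary parts *)

Lemma absC_ge_Re (z : R[i]) : `|complex.Re z| <= absC z.
Proof.
by rewrite /absC -sqrtr_sqr; apply: ler_wsqrtr; rewrite lerDl sqr_ge0.
Qed.

Lemma absC_ge_Im (z : R[i]) : `|complex.Im z| <= absC z.
Proof.
by rewrite /absC -sqrtr_sqr; apply: ler_wsqrtr; rewrite lerDr sqr_ge0.
Qed.

Lemma absC_le (z : R[i]) : absC z <= `|complex.Re z| + `|complex.Im z|.
Proof.
rewrite /absC -[leRHS]ger0_norm ?addr_ge0// -sqrtr_sqr; apply: ler_wsqrtr.
rewrite sqrrD !real_normK ?num_real// -addrA lerD2l lerDr.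
by rewrite mulrn_wge0// mulr_ge0.
Qed.

Lemma absC_ge0 (z : R[i]) : 0 <= absC z.
Proof. exact: sqrtr_ge0. Qed.

Lemma measurable_absC (f : T -> R[i]) : measC f ->
  measurable_fun setT (fun x => absC (f x)).
Proof.
move=> [mr mi]; apply: (measurableT_comp (f := @Num.sqrt R)).
  by apply: continuous_measurable_fun; exact: sqrt_continuous.
by apply: measurable_funD; exact: measurable_funX.
Qed.

Lemma inL_absC_pint s (f : T -> R[i]) : 0 < s ->
  inL mu (@absC R) (@measC d T R) s f <->
  measC f /\ (pint mu s (fun x => absC (f x)) < +oo)%E.
Proof.
move=> s0; have := inL_pint mu (fun x => absC (f x)) s0.
rewrite /inL /finite_norm => H.
have eqn : (fun x => `|absC (f x)|) = (fun x => absC (f x)).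
  by apply: funext => x; rewrite ger0_norm// absC_ge0.
rewrite eqn in H.
split=> -[mf fs]; split => //; have mabs := measurable_absC mf.
  by case: H => /(_ (conj mabs fs))[].
by case: H => _ /(_ (conj mabs fs))[].
Qed.

(** The modulus lies between the absolute value of either part and the sum of both. *)
Lemma inL_complex s (f : T -> R[i]) : 0 < s ->
  inL mu (@absC R) (@measC d T R) s f <->
  [/\ measurable_fun setT (fun x => complex.Re (f x)),
      measurable_fun setT (fun x => complex.Im (f x)),
      (pint mu s (fun x => complex.Re (f x)) < +oo)%E &
      (pint mu s (fun x => complex.Im (f x)) < +oo)%E].
Proof.
move=> s0; apply: (iff_trans (inL_absC_pint f s0)).
split=> [[mf fs]|[mr mi fr fi]].
  have mabs := measurable_absC mf; case: mf => mr mi.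
  split; [exact: mr|exact: mi| |].
    apply: le_lt_trans fs; apply: le_pint => //; first exact: ltW.
    by apply: aeW => x; rewrite [leRHS]ger0_norm ?absC_ge0// absC_ge_Re.
  apply: le_lt_trans fs; apply: le_pint => //; first exact: ltW.
  by apply: aeW => x; rewrite [leRHS]ger0_norm ?absC_ge0// absC_ge_Im.
have mf : measC f by split.
split; first exact: mf.
have mr' : measurable_fun setT (fun x => `|complex.Re (f x)|).
  exact: measurableT_comp.
have mi' : measurable_fun setT (fun x => `|complex.Im (f x)|).
  exact: measurableT_comp.
apply: (@le_lt_trans _ _
    (pint mu s (fun x => `|complex.Re (f x)| + `|complex.Im (f x)|))).
  apply: le_pint; [exact: measurable_absC|exact: measurable_funD|exact: ltW|].
  apply: aeW => x; rewrite ger0_norm ?absC_ge0// ger0_norm ?addr_ge0//.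
  exact: absC_le.
apply: le_lt_trans (pintD _ (ltW s0) mr' mi') _.
have E (h : T -> R) : pint mu s (fun x => `|h x|) = pint mu s h.
  by apply: eq_integral => x _; rewrite normr_id.
move: (2 `^ s) (powR_ge0 2 s) => k k0.
apply: lte_mul_pinfty; [by rewrite lee_fin|by []|].
by rewrite !E; apply: lte_add_pinfty; [exact: fr|exact: fi].
Qed.

Lemma ae_complex (f h : T -> R[i]) :
  {ae mu, forall x, complex.Re (f x) = complex.Re (h x)} ->
  {ae mu, forall x, complex.Im (f x) = complex.Im (h x)} ->
  {ae mu, forall x, f x = h x}.
Proof.
move=> er ei; apply: filterS2 er ei => x.
by case: (f x) (h x) => a b [a' b'] /= -> ->.
Qed.

Lemma Re_sum n (z : 'I_n -> R[i]) :
  complex.Re (\sum_(i < n) z i) = \sum_(i < n) complex.Re (z i).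
Proof. by apply: (big_morph (@complex.Re R)) => // -[a b] [a' b']. Qed.

Lemma Im_sum n (z : 'I_n -> R[i]) :
  complex.Im (\sum_(i < n) z i) = \sum_(i < n) complex.Im (z i).
Proof. by apply: (big_morph (@complex.Im R)) => // -[a b] [a' b']. Qed.

(** The complexification of [F]. *)
Let FC : set (T -> R[i]) := [set f |
  F (fun x => complex.Re (f x)) /\ F (fun x => complex.Im (f x))].

Lemma spaceable_complex :
  Lp_minus_Lq_maximal_spaceable mu (@absC R) (@measC d T R) p.
Proof.
have FL : FC `<=` inL mu (@absC R) (@measC d T R) p.
  by move=> f [[mr rp _ _] [mi ip _ _]]; apply/inL_complex.
have Fext (f h : T -> R) : f =1 h -> F f -> F h by move=> /funext ->.
exists FC; split.
- split => //.
  + move=> f h [Fr Fi] /(inL_complex _ p0)[mr mi _ _] fh; split.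
      by apply: span_family_ae Fr _ _ => //; apply: filterS fh => x ->.
    by apply: span_family_ae Fi _ _ => //; apply: filterS fh => x ->.
  + by split; exact: span_family0.
  + move=> f h [fr fi] [hr hi]; split.
      by apply: Fext (span_familyD p1 fr hr) => x; case: (f x) (h x) => ? ? [].
    by apply: Fext (span_familyD p1 fi hi) => x; case: (f x) (h x) => ? ? [].
  + move=> [a b] f [fr fi]; split.
      apply: Fext (span_familyD p1 (span_familyZ a fr) (span_familyZ (- b) fi)) => x.
      by case: (f x) => u v /=; rewrite mulNr.
    apply: Fext (span_familyD p1 (span_familyZ a fi) (span_familyZ b fr)) => x.
    by case: (f x) => u v /=.
- move=> h hL H; have [mr mi hr hi] := (inL_complex h p0).1 hL.
  have [mh _] := hL.
  have approx n : exists f, [/\ FC f,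
      (pint mu p (fun x => complex.Re (f x) - complex.Re (h x))%R <=
        (1 / (2 ^ (n + 1))%:R)%:E)%E &
      (pint mu p (fun x => complex.Im (f x) - complex.Im (h x))%R <=
        (1 / (2 ^ (n + 1))%:R)%:E)%E].
    have [f [Ff /Ldist_lt_pint fh]] := H _ (coef_gt0 p n).
    have [[fmr _ _ _] [fmi _ _ _]] := Ff.
    have mabs : measurable_fun setT (fun x => absC (f x - h x)).
      apply: measurable_absC; split.
        rewrite (_ : (fun x => _) = fun x => complex.Re (f x) - complex.Re (h x)).
          exact: measurable_funB.
        by apply: funext => x; case: (f x) (h x) => ? ? [].
      rewrite (_ : (fun x => _) = fun x => complex.Im (f x) - complex.Im (h x)).
        exact: measurable_funB.
      by apply: funext => x; case: (f x) (h x) => ? ? [].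
    exists f; split; [exact: Ff|apply: le_trans fh|apply: le_trans fh].
      apply: le_pint => //; [exact: measurable_funB|exact: ltW|apply: aeW => x].
      rewrite [leRHS]ger0_norm ?absC_ge0//; apply: le_trans (absC_ge_Re _).
      by case: (f x) (h x) => ? ? [].
    apply: le_pint => //; [exact: measurable_funB|exact: ltW|apply: aeW => x].
    rewrite [leRHS]ger0_norm ?absC_ge0//; apply: le_trans (absC_ge_Im _).
    by case: (f x) (h x) => ? ? [].
  split; apply: span_family_closed => // n; have [f [[fr fi] ar ai]] := approx n.
    by exists (fun x => complex.Re (f x)); split; [exact: fr|exact: ar].
  by exists (fun x => complex.Im (f x)); split; [exact: fi|exact: ai].
- have [c cP] := Lp_code_nat; have [v [vi vF v_ind]] := span_family_basis.
  (* Pairs of codes, one for each part, fit again into [nat -> G]. *)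
  have [k ki] := embeds_sqr_fun G.
  apply: (same_dim_embeds
    (code := fun f => k (c (fun x => complex.Re (f x)), c (fun x => complex.Im (f x))))
    (v := fun s x => (v s x)%:C%C)) => //.
  + move=> f h /(inL_complex _ p0)[fmr fmi fr fi] /(inL_complex _ p0)[hmr hmi hr hi].
    by move=> /ki[er ei]; apply: ae_complex; exact: cP.
  + move=> s s' e; apply: vi; apply: funext => x.
    by have := congr1 (fun u => complex.Re (u x)) e.
  + by move=> _ [s _ <-]; split; [exact: vF|exact: span_family0].
  + move=> n b a bi bv sum0 i.
    have /choice[s sb] : forall i, exists s, (fun x => (v s x)%:C%C) = b i.
      by move=> l; have [s _ <-] := bv l; exists s.
    have si : injective s by move=> l m e; apply: bi; rewrite -!sb e.
    (* The [v s] are real-valued, so a complex relation splits into two real ones, for the real and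
       the imaginary parts of the coefficients. *)
    have Ra : forall i, complex.Re (a i) = 0.
      apply: (v_ind _ s) => //; apply: filterS sum0 => x /(congr1 (@complex.Re R)).
      rewrite Re_sum /= => e; rewrite -[RHS]e; apply: eq_bigr => l _; rewrite -sb.
      by case: (a l) => u w /=; rewrite mulr0 subr0.
    have Ia : forall i, complex.Im (a i) = 0.
      apply: (v_ind _ s) => //; apply: filterS sum0 => x /(congr1 (@complex.Im R)).
      rewrite Im_sum /= => e; rewrite -[RHS]e; apply: eq_bigr => l _; rewrite -sb.
      by case: (a l) => u w /=; rewrite mulr0 add0r.
    by move: (Ra i) (Ia i); case: (a i) => u w /= -> ->.
- move=> f [fr fi].
  (* One nonzero part, lying in no [L_q], suffices to keep [f] out of every [L_q]. *)
  have [f0r|fq] := span_family_bad g_bad fr; last first.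
    right=> q q1p; have q0 : 0 < q by case/andP: q1p => q1 _; rewrite (lt_le_trans _ q1).
    by move=> /(inL_complex _ q0)[_ _]; rewrite fq.
  have [f0i|fq] := span_family_bad g_bad fi; last first.
    right=> q q1p; have q0 : 0 < q by case/andP: q1p => q1 _; rewrite (lt_le_trans _ q1).
    by move=> /(inL_complex _ q0)[_ _ _]; rewrite fq.
  by left; exact: ae_complex.
Qed.

End Spaceable.

(** * Exhaustion and counting of classes *)

Section RealCardinal.
Variable R : realType.

(** A real is coded by the set of rationals below it. *)
Lemma embeds_real_bits : embeds R (nat -> bool).
Proof.
exists (fun (x : R) n => ratr (odflt 0 (unpickle n) : rat) < x) => x y e.
suff le (x' y' : R) : (forall q : rat, (ratr q < x') = (ratr q < y')) -> x' <= y'.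
  have H (q : rat) : (ratr q < x) = (ratr q < y).
    by have := congr1 (fun u => u (pickle q)) e; rewrite pickleK.
  by apply/eqP; rewrite eq_le !le// => q; rewrite H.
move=> H; rewrite leNgt; apply/negP => /rat_in_itvoo[q].
by rewrite in_itv/= => /andP[yq]; rewrite H ltNge (ltW yq).
Qed.

(* Ternary expansions with digits 0 and 1. *)
Lemma embeds_bits_real : embeds (nat -> bool) R.
Proof.
pose S (b : nat -> bool) n : R := \sum_(i < n) (b i)%:R * (3^-1) ^+ i.
have SS b n : S b n.+1 = S b n + (b n)%:R * (3^-1) ^+ n by rewrite /S big_ord_recr.
have t0 n : 0 < (3^-1 : R) ^+ n by rewrite exprn_gt0.
(* The constant [3 / 2] is the sum of the full geometric series of ratio [1 / 3]. *)
have Sle b m k : S b (m + k)%N <= S b m + (3 / 2) * ((3^-1) ^+ m - (3^-1) ^+ (m + k)).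
  elim: k => [|k IH]; first by rewrite addn0 subrr mulr0 addr0.
  rewrite addnS SS exprS; move: IH (t0 (m + k)%N); case: (b _) => /=; lra.
have Shomo b m k : S b m <= S b (m + k)%N.
  elim: k => [|k IH]; first by rewrite addn0.
  rewrite addnS SS (le_trans IH)// lerDl mulr_ge0//; exact/ltW.
have Sub b m n : S b n <= S b m + (3 / 2) * (3^-1) ^+ m.
  have [mn|/ltnW nm] := leqP m n.
    by have := Sle b m (n - m)%N; rewrite subnKC//; move: (t0 n); lra.
  by have := Shomo b n (m - n)%N; rewrite subnKC//; move: (t0 m); lra.
pose X b := sup (range (S b)).
have hs b : has_sup (range (S b)).
  by split; [exists (S b 0%N), 0%N|exists (S b 0%N + 3 / 2 * (3^-1) ^+ 0) => _ [n _ <-]].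
have SX b n : S b n <= X b by apply: sup_upper_bound => //; exists n.
have XS b m : X b <= S b m + (3 / 2) * (3^-1) ^+ m.
  by apply: sup_le_ub => [|_ [n _ <-]//]; exists (S b 0%N), 0%N.
exists X => b b' e; apply: contrapT => nbb'.
have exk : exists k, b k != b' k.
  apply: contrapT => nk; apply: nbb'; apply: funext => k.
  by apply: contrapT => /eqP bk; apply: nk; exists k.
case: (ex_minnP exk) => k bk kmin.
have Sk : S b k = S b' k.
  apply: eq_bigr => i _; suff -> : b i = b' i by [].
  by apply/eqP; rewrite -[_ == _]negbK; apply/negP => /kmin; rewrite leqNgt ltn_ord.
wlog : b b' e nbb' exk bk kmin Sk / b k.
  move=> H; case E : (b k); first exact: (H b b').
  apply: (H b' b) => //; [by move=> /esym| |by rewrite eq_sym| |].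
  - by exists k; rewrite eq_sym.
  - by move=> n; rewrite eq_sym; exact: kmin.
  - by move: bk; rewrite E; case: (b' k).
move=> bk1; move: bk; rewrite bk1; case E : (b' k) => // _.
(* At the first difference [k], [b] gains [3^-1 ^+ k], while the whole tail of [b'] is worth at most
   half of that. *)
have := SX b k.+1; have := XS b' k.+1; rewrite !SS bk1 E Sk e /= exprS.
move: (t0 k); lra.
Qed.

End RealCardinal.

(** * Maximal sets up to null sets *)

Section Exhaustion.
Context d (T : measurableType d) (R : realType).
Variable mu : {measure set T -> \bar R}.

Lemma msimP (A B : set T) : measurable A -> measurable B ->
  msim mu A B <-> {ae mu, forall x, A x <-> B x}.
Proof.
move=> mA mB; split; first exact: msim_ae.
have mD : measurable ((A `\` B) `|` (B `\` A)).
  by apply: measurableU; exact: measurableD.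
move=> AB; apply/(negligibleP mu mD); apply: negligibleS AB => x /=.
by move=> [[Ax Bx]|[Bx Ax]] H; [apply: Bx|apply: Ax]; apply/H.
Qed.

Lemma null_ae (A : set T) : measurable A ->
  mu A = 0%E <-> {ae mu, forall x, ~ A x}.
Proof.
move=> mA; split=> [A0|nA].
  by exists A; split => // x /= /contrapT.
by apply/(negligibleP mu mA); apply: negligibleS nA => x /= Ax; apply.
Qed.

(** Greedy choice: each step gains at least [1 / (k + 1)] with the smallest possible [k]. If the
    union could still gain [1 / (k + 1)], then so could every step before, and the union would have
    infinite measure. *)
Lemma exhaustion (C : set (set T)) (A0 : set T) : C A0 ->
  (forall A, C A -> Sfin mu A) ->
  (forall F : nat -> set T, (forall n, C (F n)) -> nondecreasing_seq F ->
     C (\bigcup_n F n)) ->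
  exists M, C M /\ forall A, C A -> M `<=` A -> mu (A `\` M) = 0%E.
Proof.
move=> CA0 Cfin Ccup.
pose big k M A := ((k.+1%:R^-1)%:E <= mu (A `\` M))%E.
have step M : exists M', C M -> [/\ C M', M `<=` M' &
    forall k, (exists A, [/\ C A, M `<=` A & big k M A]) -> big k M M'].
  have [CM|nCM] := pselect (C M); last by exists M.
  have [nA|nA] := pselect (exists k, exists A, [/\ C A, M `<=` A & big k M A]).
    have exk : exists k, `[< exists A, [/\ C A, M `<=` A & big k M A] >].
      by case: nA => k Hk; exists k; apply/asboolP.
    case: (ex_minnP exk) => k /asboolP[A [CA MA bA]] kmin.
    exists A => _; split => // l Hl; have /kmin kl : `[< exists A, [/\ C A, M `<=` A & big l M A] >].
      exact/asboolP.
    apply: le_trans bA; rewrite lee_fin lef_pV2 ?posrE ?ltr0n//.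
    by rewrite ler_nat ltnS.
  by exists M => _; split => // k Hk; case: nA; exists k.
have [s sP] := choice step.
pose F n := iter n s A0.
have CF n : C (F n) by elim: n => // n /sP[].
have FS n : F n `<=` F n.+1 by case: (sP _ (CF n)).
have Fh : nondecreasing_seq F by apply/nondecreasing_seqP => n; exact/subsetPset.
have CFoo := Ccup F CF Fh.
exists (\bigcup_n F n); split => // A CA FA.
have mF n : measurable (F n) by case: (Cfin _ (CF n)).
have mFoo : measurable (\bigcup_n F n) by case: (Cfin _ CFoo).
have mA : measurable A by case: (Cfin _ CA).
apply/eqP/negPn/negP => mu0.
have [k bk] : exists k, big k (\bigcup_n F n) A.
  have : (0 < mu (A `\` \bigcup_n F n))%E by rewrite lt0e mu0 measure_ge0.
  rewrite /big; case: (mu _) => [r|_|//]; last by exists 0%N; rewrite leey.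
  rewrite lte_fin => r0; exists (Num.bound r^-1).
  rewrite lee_fin -[leRHS]invrK lef_pV2 ?posrE ?invr_gt0 ?ltr0n//.
  apply/ltW/(lt_trans (archi_boundP _)); first by rewrite invr_ge0 ltW.
  by rewrite ltr_nat.
have bF n : big k (F n) (F n.+1).
  have [_ _] := sP _ (CF n); apply; exists A; split => //.
    by apply: subset_trans FA; exact: bigcup_sup.
  apply: le_trans bk _; apply: le_measure; rewrite ?inE; try exact: measurableD.
  by apply: setDS; exact: bigcup_sup.
have low n : ((n%:R * k.+1%:R^-1)%:E <= mu (F n))%E.
  elim: n => [|n IH]; first by rewrite mul0r.
  rewrite -(setDUK (FS n)) measureU//; last by rewrite setDIK.
    by rewrite -natr1 mulrDl mul1r EFinD leeD//; exact: bF.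
  exact: measurableD.
have [_] := Cfin _ CFoo; rewrite ltNge leye_eq => /negP; apply.
apply/eqP/eqyP => x x0; pose n := Num.bound (x * k.+1%:R).
apply: (@le_trans _ _ (mu (F n))); last first.
  by apply: le_measure; rewrite ?inE//; exact: bigcup_sup.
apply: le_trans (low n); rewrite lee_fin ler_pdivlMr ?ltr0n//.
by apply/ltW/archi_boundP; rewrite mulr_ge0// ltW.
Qed.

End Exhaustion.

(** * Counting the subsets of a set up to null sets *)

Section Encoding.
Context d (T : measurableType d) (R : realType).
Variable mu : {measure set T -> \bar R}.

Definition encodes (X : set T) (V : Type) : Prop := exists j : set T -> V,
  forall A B, measurable A -> A `<=` X -> measurable B -> B `<=` X ->
    j A = j B -> {ae mu, forall x, A x <-> B x}.

Lemma encodes_embeds X V W : encodes X V -> embeds V W -> encodes X W.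
Proof. by move=> [j ji] [f fi]; exists (f \o j) => A B mA AX mB BX /fi; exact: ji. Qed.

Lemma encodesU X Y V W : measurable X -> measurable Y ->
  encodes X V -> encodes Y W -> encodes (X `|` Y) (V * W).
Proof.
move=> mX mY [j ji] [k ki]; exists (fun A => (j (A `&` X), k (A `&` Y))).
move=> A B mA AXY mB BXY [/ji eX /ki eY].
have {}eX := eX (measurableI _ _ mA mX) (@subIsetr _ _ _)
  (measurableI _ _ mB mX) (@subIsetr _ _ _).
have {}eY := eY (measurableI _ _ mA mY) (@subIsetr _ _ _)
  (measurableI _ _ mB mY) (@subIsetr _ _ _).
apply: filterS2 eX eY => x [AB BA] [AB' BA']; split => H.
  by case: (AXY _ H) => Hx; [case: AB|case: AB'].
by case: (BXY _ H) => Hx; [case: BA|case: BA'].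
Qed.

(** A chosen representative of the class of [A] among the measurable subsets of [X]; it depends on
    [A] only through its class. *)
Definition repr_sub (X A : set T) : set T := xget set0
  [set B | [/\ measurable B, B `<=` X & {ae mu, forall x, B x <-> A x}]].

Lemma repr_subP X A : measurable A -> A `<=` X ->
  [/\ measurable (repr_sub X A), repr_sub X A `<=` X &
      {ae mu, forall x, repr_sub X A x <-> A x}].
Proof.
move=> mA AX; rewrite /repr_sub; case: xgetP => [B _ //|/(_ A)]; case; split => //.
exact: aeW.
Qed.

Lemma repr_sub_eq X A B : {ae mu, forall x, A x <-> B x} ->
  repr_sub X A = repr_sub X B.
Proof.
move=> AB; rewrite /repr_sub; congr xget; apply/seteqP.
by split => C /= [mC CX CA]; split => //; apply: filterS2 CA AB => x -> ->.
Qed.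

(** The quotient by almost everywhere equality, realised by chosen representatives: members that
    agree almost everywhere are equal. *)
Definition sub_classes (X : set T) : Type :=
  {B : set T | exists A, [/\ measurable A, A `<=` X & B = repr_sub X A]}.

Lemma sub_classesP X (B : sub_classes X) :
  measurable (sval B) /\ sval B `<=` X.
Proof. by case: B => B [A [mA AX e]] /=; rewrite e; have [] := repr_subP mA AX. Qed.

Lemma sub_classes_eq X (B C : sub_classes X) :
  {ae mu, forall x, sval B x <-> sval C x} -> B = C.
Proof.
move=> BC; apply: sval_inj; case: B C BC => B [A [mA AX eB]] [C [A' [mA' AX' eC]]] /=.
rewrite {}eB {}eC => H.
have [_ _ E] := repr_subP mA AX; have [_ _ E'] := repr_subP mA' AX'.
by apply: repr_sub_eq; apply: filterS2 (ae_and E E') H => x [<- <-].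
Qed.

Definition to_sub_classes (X A : set T) : sub_classes X :=
  if pselect (measurable A /\ A `<=` X) is left H then
    exist _ (repr_sub X A) (ex_intro _ A (And3 H.1 H.2 erefl))
  else exist _ (repr_sub X set0)
    (ex_intro _ set0 (And3 measurable0 (@sub0set _ X) erefl)).

Lemma to_sub_classesP X A : measurable A -> A `<=` X ->
  {ae mu, forall x, sval (to_sub_classes X A) x <-> A x}.
Proof.
move=> mA AX; rewrite /to_sub_classes; case: pselect => [_ /=|]; last by case; split.
by have [] := repr_subP mA AX.
Qed.

Lemma encodes_sub_classes X : encodes X (sub_classes X).
Proof.
exists (to_sub_classes X) => A B mA AX mB BX e.
have EA := to_sub_classesP mA AX; have := to_sub_classesP mB BX.
by rewrite -e => EB; apply: filterS2 EA EB => x <- <-.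
Qed.

(** One class in each [A n] is glued to a class in the union, and recovered by restriction to the
    disjoint pieces. *)
Lemma sub_classes_bigcup (A : nat -> set T) : (forall n, measurable (A n)) ->
  trivIset setT A ->
  embeds (forall n, sub_classes (A n)) (sub_classes (\bigcup_n A n)).
Proof.
move=> mA tA.
pose U (B : forall n, sub_classes (A n)) := \bigcup_n sval (B n).
have mU B : measurable (U B).
  by apply: bigcupT_measurable => n; have [] := sub_classesP (B n).
have UA B : U B `<=` \bigcup_n A n.
  by apply: subset_bigcup => n _; have [] := sub_classesP (B n).
have UE B n x : A n x -> U B x <-> sval (B n) x.
  move=> Ax; split=> [[m _ Bx]|Bx]; last by exists n.
  suff -> : n = m by [].
  have [_ /(_ x Bx) Amx] := sub_classesP (B m).
  by apply: tA => //; exists x.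
exists (fun B => to_sub_classes _ (U B)) => B C e.
apply: functional_extensionality_dep => n; apply: sub_classes_eq.
have EB := to_sub_classesP (mU B) (UA B).
have EC := to_sub_classesP (mU C) (UA C).
rewrite -e in EC; apply: filterS2 EB EC => x HB HC.
have [Ax|nAx] := pselect (A n x); first by rewrite -!UE// -HB -HC.
by split=> H; case: nAx; have [_] := sub_classesP (B n); have [_] := sub_classesP (C n); auto.
Qed.

Let W : Type := nat -> bool.

Lemma embeds_nat_bits : embeds nat W.
Proof.
exists (fun n k => k == n) => m n e.
by have := congr1 (@^~ m) e; rewrite eqxx => /esym/eqP.
Qed.

Lemma embeds_natMl (V : Type) : V -> embeds nat (W * V).
Proof.
move=> v; have [f fi] := embeds_nat_bits.
by exists (fun n => (f n, v)) => m n [] /fi.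
Qed.

(* Up to the [#W]-many classes, all of [X] is seen inside a small subset. *)
Definition concentrated (e : R) (X : set T) : Prop := exists A,
  [/\ measurable A, A `<=` X, (mu A <= e%:E)%E & encodes X (W * sub_classes A)].

(** The small sets of [X] and [Y] are not joined: the one with more classes serves for both, since
    [W * sub_classes] absorbs its square. Hence the bound [e] does not grow. *)
Lemma concentratedU e X Y : measurable X -> measurable Y ->
  concentrated e X -> concentrated e Y -> concentrated e (X `|` Y).
Proof.
move=> mX mY [A [mA AX Ae XA]] [B [mB BY Be YB]].
have XY := encodesU mX mY XA YB.
have sq A' : embeds ((W * sub_classes A') * (W * sub_classes A')) (W * sub_classes A').
  by apply: embeds_sqr; apply: embeds_natMl; exact: (to_sub_classes A' set0).
have [AB|BA] := embeds_total (sub_classes A) (sub_classes B).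
  exists B; split => //; first by move=> x /BY; right.
  apply: encodes_embeds XY _; apply: embeds_trans (sq B).
  by apply: embeds_prod; [apply: embeds_prod => //|]; exact: embeds_refl.
exists A; split => //; first by move=> x /AX; left.
apply: encodes_embeds XY _; apply: embeds_trans (sq A).
by apply: embeds_prod; [|apply: embeds_prod => //]; exact: embeds_refl.
Qed.

Lemma concentrated_small e X : measurable X -> (mu X <= e%:E)%E -> concentrated e X.
Proof.
move=> mX Xe; exists X; split => //.
apply: encodes_embeds (encodes_sub_classes X) _.
by exists (fun B => (fun=> true, B)) => B C [].
Qed.

(** An atom has at most two classes, told apart by one bit, so the small set can be empty. *)
Lemma concentrated_atom e X : 0 <= e -> measurable X ->
  (forall B, measurable B -> B `<=` X -> mu B = 0%E \/ mu (X `\` B) = 0%E) ->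
  concentrated e X.
Proof.
move=> e0 mX atomX; exists set0; split => //; first by rewrite measure0 lee_fin.
exists (fun B => (fun=> `[< mu B = 0%E >], to_sub_classes set0 set0)).
move=> A B mA AX mB BX [/(congr1 (@^~ 0%N))] AB.
have full C : measurable C -> C `<=` X -> mu C <> 0%E -> {ae mu, forall x, X x -> C x}.
  move=> mC CX C0; case: (atomX C mC CX) => // /null_ae => /(_ (measurableD mX mC)).
  by apply: filterS => x /= H Xx; apply: contrapT => Cx; apply: H.
have [A0|A0] := pselect (mu A = 0%E).
  have /asboolP B0 : `[< mu B = 0%E >] by rewrite -AB; apply/asboolP.
  by apply: filterS2 ((null_ae _ mA).1 A0) ((null_ae _ mB).1 B0) => x; tauto.
have B0 : mu B <> 0%E by move=> /asboolP; rewrite -AB => /asboolP.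
by apply: filterS2 (full A mA AX A0) (full B mB BX B0) => x; split => [/AX|/BX]; auto.
Qed.

(* A minimal set violating the conclusion would be an atom. *)
Lemma Sfin_concentrated e X : 0 < e -> Sfin mu X -> concentrated e X.
Proof.
move=> e0 [mX Xfin]; apply: contrapT => badX.
(* For a maximal [M] in [C], the set [X] minus [M] is minimal, up to null sets, among those that are
   not concentrated. *)
pose C := [set A | [/\ measurable A, A `<=` X & ~ concentrated e (X `\` A)]].
have finsub A : A `<=` X -> measurable A -> (mu A < +oo)%E.
  by move=> AX mA; apply: le_lt_trans Xfin; apply: le_measure; rewrite ?inE.
have [||F CF Fh|M [[mM MX badM] Mmax]] := @exhaustion _ _ _ mu C set0.
- by split => //; rewrite setD0.
- by move=> A [mA AX _]; split => //; exact: finsub.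
- have mF n : measurable (F n) by case: (CF n).
  have FX n : F n `<=` X by case: (CF n).
  have mFoo := bigcupT_measurable F mF.
  have FooX : \bigcup_n F n `<=` X by move=> x [n _ /FX].
  split => // good.
  have : mu \o F @ \oo --> mu (\bigcup_n F n) by exact: nondecreasing_cvg_mu.
  have fin : mu (\bigcup_n F n) \is a fin_num by rewrite ge0_fin_numE// finsub.
  have ltfin : (mu (\bigcup_n F n) - e%:E < mu (\bigcup_n F n))%E.
    by rewrite lteBlDr// lteDl// lte_fin.
  move=> cv; have [n _ /(_ n (leqnn n))/= Fn] := cv _ (open_ereal_gt' ltfin).
  case: (CF n) => _ _; apply.
  (* [F n] misses at most [e] of the union, so its complement is a concentrated set together with a
     small one. *)
  have -> : X `\` F n = (X `\` \bigcup_n F n) `|` (\bigcup_n F n `\` F n).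
    apply/seteqP; split=> x.
      by move=> [Xx Fx]; have [|] := pselect ((\bigcup_n F n) x); [right|left].
    by move=> [[Xx H]|[/FooX Xx H]]; split => // Fx; apply: H; exists n.
  apply: concentratedU => //; try exact: measurableD.
  apply: concentrated_small; first exact: measurableD.
  rewrite measureD//; last exact: finsub.
  rewrite setIidr; last exact: bigcup_sup.
  by rewrite leeBlDr ?ge0_fin_numE ?finsub// addeC -leeBlDr// ltW.
apply: (badM); apply: concentrated_atom; [exact: ltW|exact: measurableD|].
move=> B mB BXM.
have BX : B `<=` X by move=> x /BXM[].
(* If [B] is concentrated, the union of [M] and [B] is still in [C], so [B] is null by maximality.
   If not, the complement of [B] is in [C] and contains [M], so the rest of [X] minus [M] is
   null. *)
have [good|bad] := pselect (concentrated e B).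
  left; have BM : (M `|` B) `\` M = B.
    apply/seteqP; split=> x; first by move=> [[|]].
    by move=> Bx; split; [right|case: (BXM _ Bx)].
  rewrite -BM; apply: Mmax; last exact: subsetUl.
  split; [exact: measurableU|by move=> x [/MX|/BX]|].
  rewrite setDUr => goodD; apply: badM.
  rewrite (_ : X `\` M = ((X `\` M) `&` (X `\` B)) `|` B).
    by apply: concentratedU => //; apply: measurableI; exact: measurableD.
  apply/seteqP; split=> x.
    by move=> [Xx Mx]; have [|] := pselect (B x); [right|left].
  by move=> [[]|/BXM].
right; have -> : (X `\` M) `\` B = (X `\` B) `\` M.
  by rewrite !setDDl setUC.
apply: Mmax; last by move=> x Mx; split; [exact: MX|move=> /BXM[_]].
split; [exact: measurableD|by move=> x []|].
by rewrite setDD setIidr.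
Qed.

Variable Z : Type.
Hypothesis Z_bounded : zeta_bounded mu Z.
Hypothesis bitsZ : embeds W Z.

Let natZ : embeds nat Z.
Proof. exact: embeds_trans embeds_nat_bits bitsZ. Qed.

(** The bound counts only classes of positive measure; the null class becomes [None], which an
    infinite [Z] absorbs. *)
Lemma sub_classes_bounded X : Sfin mu X -> embeds (sub_classes X) Z.
Proof.
move=> [mX Xfin]; apply: embeds_trans (embeds_option natZ).
pose S := [set B | (0 < mu B)%E /\ exists C : sub_classes X, B = sval C].
have [f [fi fS]] : exists f : set T -> option Z, {in S &, injective f} /\
    forall B, S B -> exists2 z, [set: Z] z & f B = Some z.
  apply/card_leP_embeds.
  have [X0|X0] := eqVneq (mu X) 0%E.
    suff -> : S = set0 by exact: card_ge0.
    apply/seteqP; split => // B [+ [C BE]]; rewrite BE.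
    have [mC CX] := sub_classesP C.
    by rewrite (subset_measure0 mC mX CX X0) ltxx.
  apply: (Z_bounded (A := X)) => //; first by rewrite lt0e X0 measure_ge0.
    by move=> B [C0 [C BE]]; rewrite BE in C0 *; have [mC CX] := sub_classesP C.
  move=> B' C' [_ [B ->]] [_ [C ->]] BC; congr sval; apply: sub_classes_eq.
  by apply/msimP => //; [have [] := sub_classesP B|have [] := sub_classesP C].
exists (fun B => if pselect (mu (sval B) = 0%E) then None else f (sval B)) => B C.
have [mB BX] := sub_classesP B; have [mC CX] := sub_classesP C.
have pos D : measurable D -> mu D <> 0%E -> (0 < mu D)%E.
  by move=> _ /eqP D0; rewrite lt0e D0 measure_ge0.
case: pselect => B0; case: pselect => C0.
- move=> _; apply: sub_classes_eq.
  by apply: filterS2 ((null_ae _ mB).1 B0) ((null_ae _ mC).1 C0) => x; tauto.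
- have [|z _ ->//] := fS (sval C); split; [exact: pos|by exists C].
- have [|z _ ->//] := fS (sval B); split; [exact: pos|by exists B].
- move=> /fi e; apply: sval_inj; apply: e; apply: mem_set.
    by split; [exact: pos|exists B].
  by split; [exact: pos|exists C].
Qed.

(** The union itself may have infinite measure, where the bound says nothing. Its disjoint pieces
    are therefore first concentrated on sets [A n] of summable measure, whose union falls under the
    bound. *)
Lemma sigma_finite_encodes (E : nat -> set T) : (forall n, Sfin mu (E n)) ->
  encodes (\bigcup_n E n) Z.
Proof.
move=> Efin; have mE n : measurable (E n) by case: (Efin n).
pose D := seqDU E.
have mD n : measurable (D n) by apply: measurableD => //; exact: bigsetU_measurable.
have Dfin n : Sfin mu (D n).
  split => //; apply: le_lt_trans (Efin n).2.
  by apply: le_measure; rewrite ?inE//; exact: subset_seqDU.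
pose e n : R := 1 / (2 ^ (n + 1))%:R.
have e0 n : 0 < e n by rewrite divr_gt0// ltr0n expn_gt0.
have /choice[A AP] : forall n, concentrated (e n) (D n).
  by move=> n; exact: Sfin_concentrated.
have mA n : measurable (A n) by case: (AP n).
have AD n : A n `<=` D n by case: (AP n).
have tA : trivIset setT A.
  move=> m n _ _ [x [/AD Dm /AD Dn]].
  by apply: (trivIset_seqDU E) => //; exists x.
have Afin : Sfin mu (\bigcup_n A n).
  split; first exact: bigcupT_measurable.
  apply: le_lt_trans (ltry 1); rewrite -series_half.
  rewrite measure_bigcup; [|by move=> n _; exact: mA|exact: tA].
  rewrite (@eq_eseriesl _ _ xpredT) => [|n]; last by rewrite in_setT.
  apply: lee_nneseries => [n _ _|n _]; first exact: measure_ge0.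
  by case: (AP n).
have sub_le : embeds (forall n, sub_classes (A n)) Z.
  exact: embeds_trans (sub_classes_bigcup mA tA) (sub_classes_bounded Afin).
have Z2 := embeds_sqr natZ.
have jex n : {j : set T -> W * sub_classes (A n) | forall B C,
    measurable B -> B `<=` D n -> measurable C -> C `<=` D n ->
    j B = j C -> {ae mu, forall x, B x <-> C x}}.
  by apply: cid; case: (AP n).
pose j n := sval (jex n); have jP n := svalP (jex n).
(* The product splits into a sequence of bit sequences, at most a continuum, and a class in each
   [A n]. *)
have all_le : embeds (forall n, (W * sub_classes (A n))%type) Z.
  apply: embeds_trans (embeds_trans (embeds_prod _ sub_le) Z2); last first.
    exact: embeds_trans (embeds_nat2 bool) bitsZ.
  exists (fun f => ((fun n => (f n).1), (fun n => (f n).2))) => f h fh.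
  apply: functional_extensionality_dep => n.
  have := congr1 (fun u => u.1 n) fh; have := congr1 (fun u => u.2 n) fh => /=.
  by case: (f n) (h n) => a b [a' b'] /= -> ->.
have [k ki] := all_le.
exists (fun B => k (fun n => j n (B `&` D n))) => B C mB BE mC CE /ki jBC.
have : {ae mu, forall x, forall n, (B `&` D n) x <-> (C `&` D n) x}.
  apply: ae_foralln => n; apply: (jP n); try exact: measurableI; try exact: subIsetr.
  exact: (congr1 (fun u => u n) jBC).
rewrite seqDU_bigcup_eq in BE CE.
apply: filterS => x H; split=> [Bx|Cx].
  by have [n _ Dx] := BE _ Bx; have [[]] := H n.
by have [n _ Dx] := CE _ Cx; have [_ []] := H n.
Qed.

End Encoding.

Lemma card_leT_embeds (X Y : Type) : ([set: X] #<= [set: Y])%card -> embeds X Y.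
Proof.
move=> /card_leP_embeds[f [fi fT]].
have /choice[h hP] : forall x, exists y, f x = Some y.
  by move=> x; have [y _ ->] := fT x I; exists y.
by exists h => x y e; apply: fi; rewrite ?inE// !hP e.
Qed.

(** * Bounds on [ent] as codings of sets of finite measure *)

Section Classes.
Context d (T : measurableType d) (R : realType).
Variable mu : {measure set T -> \bar R}.

Let cls (A : set T) := [set B | Sfin mu B /\ msim mu B A].

Lemma cls_eq A B : Sfin mu A -> Sfin mu B -> msim mu A B <-> cls A = cls B.
Proof.
move=> fA fB; have [mA _] := fA; have [mB _] := fB.
split=> [/(msimP _ mA mB) AB|e]; last first.
  suff : cls B A by case.
  by rewrite -e; split => //; apply/msimP => //; exact: aeW.
apply/seteqP; split=> C [fC /msimP]; have [mC _] := fC.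
  by move=> /(_ mC mA) CA; split => //; apply/msimP => //; apply: filterS2 CA AB => x -> ->.
by move=> /(_ mC mB) CB; split => //; apply/msimP => //; apply: filterS2 CB AB => x -> ->.
Qed.

Lemma Sfin_set0 : Sfin mu set0.
Proof. by split => //; rewrite measure0. Qed.

Lemma Sfin_classes_code (V : Type) : (Sfin_classes mu #<= [set: V])%card ->
  exists j : set T -> V, forall A B, Sfin mu A -> Sfin mu B -> j A = j B -> msim mu A B.
Proof.
move=> /card_leP_embeds[f [fi fS]].
have Scls A : Sfin mu A -> Sfin_classes mu (cls A) by move=> fA; exists A.
(* The class of [set0] shows that [V] is inhabited; [y0] is a default value. *)
have [y0 _ _] := fS _ (Scls _ Sfin_set0).
exists (fun A => odflt y0 (f (cls A))) => A B fA fB.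
have [a _ fa] := fS _ (Scls _ fA); have [b _ fb] := fS _ (Scls _ fB).
rewrite fa fb /= => ab; apply/cls_eq => //.
by apply: fi; rewrite ?inE; [exact: Scls|exact: Scls|rewrite fa fb ab].
Qed.

Lemma code_Sfin_classes (V : Type) (j : set T -> V) :
  (forall A B, Sfin mu A -> Sfin mu B -> j A = j B -> msim mu A B) ->
  (Sfin_classes mu #<= [set: V])%card.
Proof.
move=> ji; apply/card_leP_embeds.
have /choice[r rP] : forall C, exists A, Sfin_classes mu C -> Sfin mu A /\ C = cls A.
  move=> C; have [[A HA]|nC] := pselect (Sfin_classes mu C); last by exists set0.
  by exists A.
exists (fun C => Some (j (r C))); split=> [C C' /set_mem HC /set_mem HC' []|C HC].
  have [fr {2}->] := rP _ HC; have [fr' {2}->] := rP _ HC'.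
  by move=> /ji => /(_ fr fr')/cls_eq; apply.
by exists (j (r C)).
Qed.

End Classes.

(** * The two cases of the theorem *)

Section Cases.
Context d (T : measurableType d) (R : realType).
Variables (mu : {measure set T -> \bar R}) (p : R).
Hypothesis p1 : 1 < p.

Let p0 : 0 < p. Proof. by rewrite (lt_trans _ p1). Qed.

(** What both cases provide: an infinite disjoint family of bad functions indexed by [G], with [j]
    expressing [ent <= #G ^ aleph_0]. *)
Definition spaceable_data : Prop := exists (G : Type) (g : G -> T -> R)
    (j : set T -> nat -> G),
  [/\ forall c, bad mu p (g c),
      forall c e, c <> e -> {ae mu, forall x, g c x = 0 \/ g e x = 0},
      embeds nat G &
      forall A B, Sfin mu A -> Sfin mu B -> j A = j B -> msim mu A B].

(** These sets have finite measure for [f] in [L_p] and increase to the support of [f]. *)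
Definition level (f : T -> R) (n : nat) : set T := [set x | n.+1%:R^-1 <= `|f x|].

Lemma level_Sfin (f : T -> R) n : measurable_fun setT f -> (pint mu p f < +oo)%E ->
  Sfin mu (level f n).
Proof.
move=> mf fp; have mL : measurable (level f n).
  have mn : measurable_fun setT (fun x => `|f x|) by exact: measurableT_comp.
  have := mn measurableT _ (measurable_itv `[n.+1%:R^-1, +oo[).
  rewrite setTI; congr measurable; apply/seteqP.
  by split=> x; rewrite /level /= in_itv/= andbT.
by split => //; exact: (level_fin p1 mf fp mL (a := n.+1%:R^-1)).
Qed.

Lemma level_homo (f : T -> R) : nondecreasing_seq (level f).
Proof.
move=> m n mn; apply/subsetPset => x; apply: le_trans.
by rewrite lef_pV2 ?posrE ?ltr0n// ler_nat ltnS.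
Qed.

Lemma bigcup_level (f : T -> R) : \bigcup_n level f n = [set x | f x <> 0].
Proof.
apply/seteqP; split=> x.
  move=> [n _ fx] f0; move: fx; rewrite /level /= f0 normr0 leNgt.
  by rewrite invr_gt0 ltr0n.
move=> /= /eqP fx; exists (Num.bound `|f x|^-1) => //; rewrite /level /=.
have f0 : 0 < `|f x|^-1 by rewrite invr_gt0 normr_gt0.
rewrite -[leRHS]invrK lef_pV2 ?posrE ?ltr0n//.
apply/ltW/(lt_trans (archi_boundP (ltW f0))); by rewrite ltr_nat.
Qed.

Lemma data_of_cardinal_le_real (r : R) (f : T -> R) : 1 <= r < p ->
  inL mu (@Num.norm _ R) (@measR d T R) p f ->
  ~ inL mu (@Num.norm _ R) (@measR d T R) r f ->
  (Sfin_classes mu #<= [set: R])%card -> spaceable_data.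
Proof.
move=> /andP[r1 rp] /(inL_pint _ _ p0)[mf fp] nfr ent.
have r0 : 0 < r by rewrite (lt_le_trans _ r1).
(* On a support of finite measure, [|f| ^ r <= |f| ^ p + 1] would put [f] in [L_r]. *)
have supp_inf : mu (\bigcup_n level f n) = +oo%E.
  rewrite bigcup_level; apply/eqP; rewrite -leye_eq leNgt; apply/negP => fin.
  apply: nfr; apply/(inL_pint _ _ r0); split; first exact: mf.
  have mS := measurable_support mf.
  have mE : measurable_fun setT (EFin \o \1_[set x | f x <> 0] : T -> \bar R).
    exact/measurable_EFinP/measurable_indic.
  apply: (@le_lt_trans _ _
      (\int[mu]_x ((`|f x| `^ p)%:E + (\1_[set x | f x <> 0] x)%:E))%E); last first.
    rewrite ge0_integralD//; last exact: measurable_pint.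
    rewrite integral_indic// setIT.
    by apply: lte_add_pinfty; [exact: fp|exact: fin].
  apply: ge0_le_integral => //.
  - exact: measurable_pint.
  - by apply: emeasurable_funD; [exact: measurable_pint|exact: mE].
  - move=> x _; rewrite -EFinD lee_fin indicE.
    have [f0|f0] := eqVneq (f x) 0.
      rewrite f0 normr0 !powR0 ?gt_eqF// memNset ?addr0//=.
    rewrite mem_set /=; last exact/eqP.
    have [f1|f1] := leP 1 `|f x|.
      by apply: (@le_trans _ _ (`|f x| `^ p)); [apply: ler_powR => //; exact: ltW|rewrite lerDl].
    apply: (@le_trans _ _ 1); last by rewrite lerDr powR_ge0.
    rewrite -(powRr0 `|f x|); apply: ger_powR; last exact: ltW.
    by rewrite normr_gt0 f0 ltW.
have [g [g_bad _ g_disj]] := bad_family p1 (fun n => (level_Sfin n mf fp).1)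
  (fun n => (level_Sfin n mf fp).2) (level_homo f) supp_inf.
have [j ji] := Sfin_classes_code ent.
have [k ki] : embeds R (nat -> nat).
  apply: embeds_trans (embeds_real_bits R) _; apply: embeds_fun.
  by exists nat_of_bool => -[] [].
exists nat, g, (k \o j); split => //.
- move=> m n mn; apply: aeW => x; apply: contrapT => /not_orP[/= gm gn].
  exact/mn/(g_disj m n x).
- exact: embeds_refl.
- by move=> A B fA fB /ki; exact: ji.
Qed.

Definition supp (o : option (T -> R)) : set T :=
  if o is Some f then [set x | f x <> 0] else set0.

(** Cuts the supports into level sets, which exhibits the union as sigma-finite when [A] has finite
    measure and the functions are in [L_p]. *)
Lemma bigcup_supp_pair (sg : nat -> option (T -> R)) (A : set T) :
  A `|` \bigcup_n supp (sg n) =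
  \bigcup_n (A `|` (let mk := odflt (0, 0)%N (unpickle n) in
                    if sg mk.1 is Some f then level f mk.2 else set0)).
Proof.
apply/seteqP; split=> x.
  move=> [Ax|[m _]]; first by exists 0%N => //; left.
  case E : (sg m) => [f|//]; rewrite /= -/([set y | f y <> 0] x) -bigcup_level => -[k _ fx].
  by exists (pickle (m, k)) => //; right; rewrite pickleK /= E.
move=> [n _ [Ax|]]; first by left.
case: (odflt _ _) => m k /=; case E : (sg m) => [f|//] fx; right; exists m => //.
by rewrite E /= -/([set y | f y <> 0] x) -bigcup_level; exists k.
Qed.

Lemma data_of_bounded (Z : Type) : zeta_bounded mu Z ->
  ([set: R] #<= [set: Z])%card -> ~ (Sfin_classes mu #<= [set: Z])%card ->
  spaceable_data.
Proof.
move=> Zb /card_leT_embeds RZ nent.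
have bitsZ := embeds_trans (embeds_bits_real R) RZ.
have natZ := embeds_trans embeds_nat_bits bitsZ.
pose P := [set S : set (T -> R) | (forall f, S f -> bad mu p f) /\
  forall f h, S f -> S h -> f <> h -> {ae mu, forall x, f x = 0 \/ h x = 0}].
have [C CP Ctot|S [[Sbad Sdisj] Smax]] := @Zorn_bigcup _ P.
  split=> [f [A /CP[Ab _]]|f h [A CA Af] [B CB Bh]]; first exact: Ab.
  case: (Ctot _ _ CA CB) => AB.
    by have [_] := CP _ CB; apply => //; exact: AB.
  by have [_] := CP _ CA; apply => //; exact: AB.
have mS f : S f -> measurable_fun setT f by move=> /Sbad[].
have Sfin_level f n : S f -> Sfin mu (level f n).
  move=> /Sbad[mf _ fp _]; apply: level_Sfin mf _.
  exact: le_lt_trans fp (ltry _).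
pose N := [set A | Sfin mu A /\ forall f, S f -> {ae mu, forall x, A x -> f x = 0}].
(* If the union had infinite measure, it would carry a bad function disjoint from all members of
   [S], against maximality. *)
have Ncup (F : nat -> set T) : (forall n, N (F n)) -> nondecreasing_seq F ->
    N (\bigcup_n F n).
  move=> NF Fh; have mF n : measurable (F n) by case: (NF n) => -[].
  have zero f : S f -> {ae mu, forall x, (\bigcup_n F n) x -> f x = 0}.
    move=> Sf; have := ae_foralln (fun n => (NF n).2 f Sf).
    by apply: filterS => x H [n _]; exact: H.
  split => //; split; first exact: bigcupT_measurable.
  rewrite ltNge leye_eq; apply/negP => /eqP Finf.
  have [g [/(_ 0%N) g_bad /(_ 0%N) gF _]] :=
    bad_family p1 mF (fun n => (NF n).1.2) Fh Finf.
  have gz f : S f -> {ae mu, forall x, f x = 0 \/ g 0%N x = 0}.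
    move=> Sf; apply: filterS (zero f Sf) => x H.
    have [->|/eqP gx] := eqVneq (g 0%N x) 0; first by right.
    by left; apply: H; have [n Fx] := gF x gx; exists n.
  (* A member of [S] would be almost everywhere disjoint from [g 0]; [g 0] itself is not. *)
  have nSg : ~ S (g 0%N).
    move=> /gz g0; have [x + gx] := bad_nonzero p1 (fun _ : unit => g_bad) tt g0.
    by case.
  apply: (Smax (S `|` [set g 0%N])).
    split; first by move=> f; left.
    by move=> /(_ _ (or_intror erefl)).
  split; first by move=> f [/Sbad|->].
  move=> f h [Sf|->] [Sh|->] fh //; [exact: Sdisj|exact: gz|].
  by apply: filterS (gz h Sh) => x []; [right|left].
have N0 : N set0 by split; [exact: Sfin_set0|move=> f _; exact: aeW].
have [R0 [NR0 R0max]] := exhaustion N0 (fun A => @proj1 _ _) Ncup.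
have [[mR0 R0fin] R0z] := NR0.
pose okseq (sg : nat -> option (T -> R)) := forall n f, sg n = Some f -> S f.
have msupp sg n : okseq sg -> measurable (supp (sg n)).
  rewrite /okseq => /(_ n); case: (sg n) => [f Sf|_]; last exact: measurable0.
  by apply: measurable_support; apply: mS; exact: Sf.
have mbig sg : okseq sg -> measurable (\bigcup_n supp (sg n)).
  by move=> ok; apply: bigcupT_measurable => n; exact: msupp.
(* Exhaust [A] by its intersections with countable unions of supports. What is left meets every
   support in a null set, hence lies in [N] and, by the choice of [R0], inside [R0] up to a null
   set. *)
have cover A : Sfin mu A -> exists sg, okseq sg /\
    mu (A `\` (R0 `|` \bigcup_n supp (sg n))) = 0%E.
  move=> [mA Afin].
  pose C := [set B | exists sg, okseq sg /\ B = A `&` \bigcup_n supp (sg n)].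
  have C0 : C set0.
    exists (fun=> None); split => //; rewrite bigcup0 ?setI0//.
  have Cfin B : C B -> Sfin mu B.
    move=> [sg [ok ->]]; have mB := measurableI _ _ mA (mbig sg ok); split => //.
    by apply: le_lt_trans Afin; apply: le_measure; rewrite ?inE//; exact: subIsetl.
  have Ccup (F : nat -> set T) : (forall n, C (F n)) -> nondecreasing_seq F ->
      C (\bigcup_n F n).
    move=> /choice[sg sgP] _.
    exists (fun n => let mk := odflt (0, 0)%N (unpickle n) in sg mk.1 mk.2).
    split; first by move=> n f /=; case: (sgP (odflt (0, 0)%N (unpickle n)).1) => + _; apply.
    apply/seteqP; split=> x.
      move=> [m _]; rewrite (sgP m).2 => -[Ax [k _ sx]]; split => //.
      by exists (pickle (m, k)); rewrite //= pickleK.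
    move=> [Ax [n _ sx]]; exists (odflt (0, 0)%N (unpickle n)).1 => //.
    by rewrite (sgP _).2; split => //; eexists; last exact: sx.
  have [_ [[sg [ok ->]] Cmax]] := exhaustion C0 Cfin Ccup.
  exists sg; split => //.
  have mV := mbig sg ok.
  have NA : N (A `\` \bigcup_n supp (sg n)).
    split; first split; first exact: measurableD.
      by apply: le_lt_trans Afin; apply: le_measure; rewrite ?inE//;
        first [exact: measurableD|exact: subDsetl].
    move=> f Sf; have mf := measurable_support (mS f Sf).
    (* Adding one more support [f] to the sequence gains nothing, by maximality. *)
    pose sg' n := if n is n'.+1 then sg n' else Some f.
    have ok' : okseq sg' by case=> [h [<-]//|n h]; exact: ok.
    have /Cmax : C (A `&` \bigcup_n supp (sg' n)) by exists sg'.
    have sub : A `&` \bigcup_n supp (sg n) `<=` A `&` \bigcup_n supp (sg' n).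
      by move=> x [Ax [n _ sx]]; split => //; exists n.+1.
    move=> /(_ sub)/null_ae => /(_ (measurableD (measurableI _ _ mA (mbig sg' ok'))
      (measurableI _ _ mA mV))).
    apply: filterS => x H [Ax nV]; apply: contrapT => fx; apply: H; split.
      by split => //; exists 0%N.
    by move=> [_].
  have /R0max/(_ (@subsetUl _ _ _)) : N (R0 `|` (A `\` \bigcup_n supp (sg n))).
    split.
      have [[mD Dfin] _] := NA; split; first exact: measurableU.
      apply: le_lt_trans (measureU2 _ mR0 mD) _.
      by apply: lte_add_pinfty; [exact: R0fin|exact: Dfin].
    move=> f Sf; apply: filterS2 (R0z f Sf) (NA.2 f Sf) => x H1 H2.
    by move=> [/H1|/H2].
  by rewrite setDUl setDv set0U setDDl (setUC R0).
pose G : Type := {f | S f}.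
pose U (s : nat -> option G) := R0 `|` \bigcup_n supp (omap sval (s n)).
have mU s : measurable (U s).
  apply: measurableU => //; apply: mbig => n f.
  by case: (s n) => [[h Sh]|//] /= [<-].
have Uenc s : encodes mu (U s) Z.
  rewrite /U bigcup_supp_pair; apply: sigma_finite_encodes => // n.
  case: (odflt _ _) => m k /=; case: (s m) => [[f Sf]|] /=; last by rewrite setU0.
  have [mL Lfin] := Sfin_level f k Sf; split; first exact: measurableU.
  apply: le_lt_trans (measureU2 _ mR0 mL) _.
  by apply: lte_add_pinfty; [exact: R0fin|exact: Lfin].
have /choice[tr trP] : forall A, exists s : nat -> option G,
    Sfin mu A -> mu (A `\` U s) = 0%E.
  move=> A; have [/cover[s [ok As]]|nA] := pselect (Sfin mu A); last by exists (fun=> None).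
  exists (fun n => match s n as o return (forall f, o = Some f -> S f) -> option G with
    | Some f => fun H => Some (exist _ f (H f erefl)) | None => fun=> None end (ok n)) => _.
  rewrite /U; rewrite -[RHS]As; congr (mu (A `\` (R0 `|` _))).
  apply: eq_bigcupr => n _; congr supp.
  by move: (ok n); case: (s n).
have [u uP] := choice Uenc.
(* A set is coded by a sequence of supports covering it together with [R0], and by its class inside
   that sigma-finite cover. *)
pose code A := (tr A, u (tr A) (A `&` U (tr A))).
have codeP A B : Sfin mu A -> Sfin mu B -> code A = code B -> msim mu A B.
  move=> fA fB; rewrite /code => -[sAB]; rewrite sAB => uAB.
  have [mA _] := fA; have [mB _] := fB; apply/msimP => //.
  have /(null_ae _ (measurableD mA (mU _))) nA := trP A fA.
  have /(null_ae _ (measurableD mB (mU _))) nB := trP B fB.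
  have := uP (tr B) _ _ (measurableI _ _ mA (mU (tr B))) (@subIsetr _ _ _)
    (measurableI _ _ mB (mU (tr B))) (@subIsetr _ _ _) uAB.
  rewrite sAB in nA.
  move=> AB; apply: filterS2 (ae_and nA nB) AB => x [HA HB] [H1 H2].
  split=> Hx.
    by apply: contrapT => nBx; have [Ux|nUx] := pselect (U (tr B) x);
      [case: nBx; case: H1|case: HA].
  by apply: contrapT => nAx; have [Ux|nUx] := pselect (U (tr B) x);
      [case: nAx; case: H2|case: HB].
(* Otherwise [code] would bound [ent] by [Z]. *)
have nQZ : ~ embeds (nat -> option G) Z.
  move=> QZ; apply: nent.
  have [k ki] : embeds ((nat -> option G) * Z) Z.
    exact: embeds_trans (embeds_prod QZ (embeds_refl _)) (embeds_sqr natZ).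
  by apply: (code_Sfin_classes (j := k \o code)) => A B fA fB /ki; exact: codeP.
(* For countable [G] the sequences would number at most a continuum, hence embed into [Z]. *)
have natG : embeds nat G.
  have [//|Gnat] := embeds_total nat G; exfalso; apply: nQZ.
  apply: embeds_trans (embeds_trans (embeds_nat2 bool) bitsZ).
  apply: embeds_fun; apply: embeds_trans embeds_nat_bits.
  apply: embeds_trans _ (embeds_option (embeds_refl nat)).
  by have [k ki] := Gnat; exists (omap k); exact: inj_omap.
(* Comparability turns the failure of [nat -> option G] to embed into [Z] into the converse
   embedding. *)
have ZQ : embeds Z (nat -> G).
  have QG : embeds (nat -> option G) (nat -> G) by apply: embeds_fun; exact: embeds_option.
  by have [ZQ|//] := embeds_total Z (nat -> option G); apply: embeds_trans QG.
have [k ki] : embeds ((nat -> option G) * Z) (nat -> G).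
  apply: embeds_trans (embeds_sqr_fun G); apply: embeds_prod => //.
  by apply: embeds_fun; exact: embeds_option.
exists G, sval, (k \o code); split => //.
- by move=> [f Sf]; exact: Sbad.
- move=> [f Sf] [h Sh] fh; apply: Sdisj => // e; apply: fh; exact: eq_exist.
- by move=> A B fA fB /ki; exact: codeP.
Qed.

End Cases.

Theorem theorem3p5 (d : measure_display) (T : measurableType d) (R : realType)
    (mu : {measure set T -> \bar R}) (p : R) :
  mu [set: T] = +oo%E -> 1 < p ->
  ( ( (exists r : R, 1 <= r < p /\
         exists f : T -> R, inL mu (@Num.norm _ R) (@measR d T R) p f /\
                            ~ inL mu (@Num.norm _ R) (@measR d T R) r f) /\
      ([set: nat] #<= Sfin_classes mu)%card /\
      (Sfin_classes mu #<= [set: R])%card )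
  \/
    (exists Z : Type,
      [/\ zeta_bounded mu Z,
          ([set: R] #<= [set: Z])%card,
          ([set: Z] #<= Sfin_classes mu)%card &
          ~ (Sfin_classes mu #<= [set: Z])%card]) ) ->
  Lp_minus_Lq_maximal_spaceable mu (@Num.norm _ R) (@measR d T R) p /\
  Lp_minus_Lq_maximal_spaceable mu (@absC R) (@measC d T R) p.
Proof.
move=> _ p1 H.
(* Both cases lead to the same data, which serve the real and the complex scalars alike. *)
have [G [g [j [g_bad g_disj natG j_inj]]]] : spaceable_data mu p.
  case: H => [[[r [rp [f [fp nfr]]]] [_ ent]]|[Z [Zb RZ _ nent]]].
    exact: data_of_cardinal_le_real rp fp nfr ent.
  exact: data_of_bounded Zb RZ nent.
by split; [exact: spaceable_real g_bad g_disj natG j_inj|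
  exact: spaceable_complex g_bad g_disj natG j_inj].
Qed.
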